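(* For every Lebesgue measurable set $E\subseteq\mathbb{R}$ there exists a $G_\delta$ set $\widetilde{E}\subseteq\mathbb{R}$ which is a $\operatorname{Lip} 1$ set and satisfies $|E\,\triangle\,\widetilde{E}|=0$.
   Context: $|A|$ denotes the Lebesgue measure of $A\subseteq\mathbb{R}$. For a continuous $f:\mathbb{R}\to\mathbb{R}$, $x\in\mathbb{R}$ and $r>0$ let $M_f(x,r)=\frac{\sup\{|f(x)-f(y)| : |x-y|\le r\}}{r}$ and $\operatorname{Lip} f(x)=\limsup_{r\to 0^+}M_f(x,r)$. A set $E\subseteq\mathbb{R}$ is called a $\operatorname{Lip} 1$ set if there exists a continuous function $f:\mathbb{R}\to\mathbb{R}$ with $\operatorname{Lip} f=\mathbf{1}_E$ (the indicator function of $E$) on all of $\mathbb{R}$. *)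

(* Defs.v *)
From HB Require Import structures.
From mathcomp Require Import all_boot all_order all_algebra.
From mathcomp Require Import all_classical all_reals all_analysis.
From mathcomp Require Import borel_hierarchy.
Set Implicit Arguments.
Unset Strict Implicit.
Unset Printing Implicit Defensive.
Import Order.TTheory GRing.Theory Num.Theory.
Import numFieldNormedType.Exports.
Local Open Scope classical_set_scope.
Local Open Scope ring_scope.

(* Lebesgue measurable sets: Caratheodory-measurable w.r.t. the Lebesgue
   outer measure (= the sigma-algebra of the completed Lebesgue measure,
   cf. completed_caratheodory_measurable). *)
Definition lebesgue_measurable {R : realType} (E : set R) : Prop :=
  (@wlength R idfun)^*%mu.-cara.-measurable E.

Definition Mf {R : realType} (f : R -> R) (x r : R) : \bar R :=
  ereal_sup [set ((`|f x - f y| / r)%R)%:E | y in [set y | `|x - y| <= r]].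

Definition Lip {R : realType} (f : R -> R) (x : R) : \bar R :=
  limf_esup (Mf f x) (0%R)^'+.

Definition Lip1_set {R : realType} (E : set R) : Prop :=
  exists f : R -> R, continuous f /\ forall x : R, Lip f x = (\1_E x)%:E.

(* Main.v *)
Require Import Defs.
From HB Require Import structures.
From mathcomp Require Import all_boot all_order all_algebra.
From mathcomp Require Import all_classical all_reals all_analysis.
From mathcomp Require Import borel_hierarchy.
From mathcomp Require Import measurable_realfun ring lra.
Set Implicit Arguments.
Unset Strict Implicit.
Unset Printing Implicit Defensive.
Import Order.TTheory GRing.Theory Num.Theory.
Import numFieldNormedType.Exports.
Local Open Scope classical_set_scope.
Local Open Scope ring_scope.

(**
Up to a null set [E] is Borel; let [F] be a primitive of its indicator, so that
[|F x - F y|] is the measure of [E] between [x] and [y].  The function [f] is a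
limit of functions [f_n] that are Lipschitz with constant [L_n < 1] for the
pseudometric [|F x - F y|], where [L_n] increases to [1].  Each [f_n] comes with
a tolerance [rho_n >= 0]: all later stages stay within [rho_n] of [f_n].  At a
zero [z] of [rho_n] both [f_n] and [rho_n] are [o(|y - z|)], hence
[Lip f z = 0].  If [rho_n x > 0], then [f_n] has slope about [L_n] from [x]
to some point [y] whose distance to [x] is small but much larger than [rho_n x].
So [Lip f] is the indicator of the G_delta set where all [rho_n] are positive.

In the step from [n] to [n + 1], the new tolerance is supported on intervals
whose end points are density points of [E], and is of smaller order than the
distance to these end points, yet [E] has density almost [1] at scale [rho] in
every point where [rho > 0] (the intervals cover almost all of [E]).  First
[f_n] is made locally constant near the new zeros, by discarding from [E] a
neighbourhood of them of small relative measure.  Then it is replaced by its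
extremal Lipschitz extension from a locally finite set of dyadic nodes, which
has the maximal slope in every gap between nodes.
*)

(** * Pointwise suprema of families of functions *)

Section supf.
Context {R : realType} {I : Type}.
Implicit Types (D : set I) (g : I -> R -> R).

Definition supf D g (x : R) : R := sup [set g i x | i in D].

Lemma supf_ge D g x M i :
  (forall j, D j -> g j x <= M) -> D i -> g i x <= supf D g x.
Proof.
move=> gM Di; apply: ub_le_sup; last by exists i.
by exists M => _ [j Dj <-]; exact: gM.
Qed.

Lemma supf_le D g x M :
  D !=set0 -> (forall j, D j -> g j x <= M) -> supf D g x <= M.
Proof.
move=> [i Di] gM; apply: ge_sup; first by exists (g i x), i.
by move=> _ [j Dj <-]; exact: gM.
Qed.

Lemma supf_adherent D g x M e : D !=set0 -> (forall j, D j -> g j x <= M) ->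
  0 < e -> exists2 i, D i & supf D g x - e < g i x.
Proof.
move=> [i Di] gM e0.
have hs : has_sup [set g i x | i in D].
  split; first by exists (g i x), i.
  by exists M => _ [j Dj <-]; exact: gM.
by have [_ [j Dj <-] lt] := sup_adherent e0 hs; exists j.
Qed.

End supf.

(** * Lipschitz functions for the pseudometric of [F], and density deficits *)

Section lipwrt.
Context {R : realType}.
Implicit Types (F g f : R -> R) (x y z r s a b c : R).

Definition lipwrt F c g := forall x y, `|g x - g y| <= c * `|F x - F y|.

Lemma lipwrt_le F c g : (forall x y, g x - g y <= c * `|F x - F y|) -> lipwrt F c g.
Proof.
move=> H x y; rewrite ler_norml lerNl opprB H andbT.
by rewrite distrC H.
Qed.

Lemma lipwrt_cst F c k : 0 <= c -> lipwrt F c (fun=> k).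
Proof. by move=> c0 x y; rewrite subrr normr0 mulr_ge0. Qed.

Lemma lipwrt_subr F k : lipwrt F 1 (fun x => F x - k).
Proof. by move=> x y; rewrite mul1r opprB addrA subrK. Qed.

Lemma lipwrt_subl F k : lipwrt F 1 (fun x => k - F x).
Proof. by move=> x y; rewrite mul1r opprB addrC addrA subrK distrC. Qed.

Lemma lipwrt_max F c g f :
  lipwrt F c g -> lipwrt F c f -> lipwrt F c (fun x => Num.max (g x) (f x)).
Proof.
move=> Hg Hf; apply: lipwrt_le => x y.
move: (Hg x y) (Hf x y); rewrite !ler_norml => /andP[_ gxy] /andP[_ fxy].
by rewrite /Num.max; case: ltP => ?; case: ltP => ?; lra.
Qed.

Lemma lipwrt_min F c g f :
  lipwrt F c g -> lipwrt F c f -> lipwrt F c (fun x => Num.min (g x) (f x)).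
Proof.
move=> Hg Hf; apply: lipwrt_le => x y.
move: (Hg x y) (Hf x y); rewrite !ler_norml => /andP[_ gxy] /andP[_ fxy].
by rewrite /Num.min; case: ltP => ?; case: ltP => ?; lra.
Qed.

Lemma lipwrt_supf {I : Type} (D : set I) F c (g : I -> R -> R) :
  D !=set0 -> (forall i, D i -> lipwrt F c (g i)) ->
  (forall x, exists M, forall i, D i -> g i x <= M) ->
  lipwrt F c (supf D g).
Proof.
move=> D0 gL gB; apply: lipwrt_le => x y.
rewrite lerBlDr; apply: supf_le => // i Di.
have [M gM] := gB y; have := supf_ge gM Di.
by have := gL i Di x y; rewrite ler_norml => /andP[_]; lra.
Qed.

(* [nonexp F]: distribution functions of measures with density in [0, 1] *)
Definition nonexp F := forall x y, x <= y -> 0 <= F y - F x <= y - x.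

Lemma nonexp_le F x y : nonexp F -> x <= y -> F x <= F y.
Proof. by move=> HF /HF; lra. Qed.

Lemma nonexp_dist F x y : nonexp F -> `|F x - F y| <= `|x - y|.
Proof.
move=> HF; have [xy|/ltW yx] := leP x y.
  by rewrite distrC (distrC x) !ger0_norm ?subr_ge0//; have := HF _ _ xy; lra.
by rewrite !ger0_norm ?subr_ge0//; have := HF _ _ yx; lra.
Qed.

Lemma lipwrt_dist F c g : nonexp F -> 0 <= c -> lipwrt F c g ->
  forall x y, `|g x - g y| <= c * `|x - y|.
Proof.
move=> HF c0 gL x y; rewrite (le_trans (gL x y))// ler_wpM2l//.
exact: nonexp_dist.
Qed.

(** When [F] is the distribution function of a set, this is the measure of the complement of the set
    in the interval of radius [r] about [x]. *)
Definition deficit F x r := 2 * r - (F (x + r) - F (x - r)).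

Lemma interval_deficit F x r u v : nonexp F -> x - r <= u -> u <= v ->
  v <= x + r -> (v - u) - (F v - F u) <= deficit F x r.
Proof.
move=> HF xu uv vx; rewrite /deficit.
have := HF _ _ xu; have := HF _ _ vx; lra.
Qed.

Lemma deficit_sub F x r y s : nonexp F -> 0 <= r -> x - r >= y - s ->
  x + r <= y + s -> deficit F x r <= deficit F y s.
Proof.
move=> HF r0 h1 h2.
have := interval_deficit HF h1 (_ : x - r <= x + r) h2.
by rewrite /deficit => /(_ ltac:(lra)); lra.
Qed.

Lemma deficit_ge0 F x r : nonexp F -> 0 <= r -> 0 <= deficit F x r.
Proof.
move=> HF r0; have := HF (x - r) (x + r) ltac:(lra); rewrite /deficit; lra.
Qed.

Lemma deficit0 F x : deficit F x 0 = 0.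
Proof. by rewrite /deficit addr0 subr0; lra. Qed.

(** Differentiability at [z] with derivative 0. *)
Definition flat_at g z := forall c, 0 < c ->
  exists2 d, 0 < d & forall y, `|y - z| < d -> `|g y - g z| <= c * `|y - z|.

Definition density_at F x := forall c, 0 < c ->
  exists2 d, 0 < d & forall r, 0 < r -> r < d -> deficit F x r <= c * r.

End lipwrt.

(** * A tolerance vanishing at a single density point *)

Section point_function.
Context {R : realType}.
Implicit Types (F : R -> R) (a l eta eps r x y c : R).

(* The function is a supremum of truncated cones with apex height [h r] over
   [|x - a| >= r]; [h r] dominates the deficit at scale [2 r], and density at
   [a] forces each cone to vanish on [|x - a| < r / 2]. *)
Lemma point_function F a l eta eps : nonexp F -> 0 < l -> l <= 1 ->
  0 < eta -> 0 < eps -> eps <= 1 -> 64 * eta <= eps ->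
  (forall r, 0 < r -> r <= 2 * l -> deficit F a r <= eta * r) ->
  density_at F a ->
  exists Phi : R -> R,
  [/\ [/\ forall x, 0 <= Phi x, lipwrt F (8^-1) Phi & Phi a = 0],
      forall x, 0 < `|x - a| -> `|x - a| <= l ->
        0 < Phi x /\ deficit F a (2 * `|x - a|) <= eps * Phi x,
      forall x, Phi x <= 6 * (eta / eps) * `|x - a| &
      flat_at Phi a].
Proof.
move=> HF l0 l1 eta0 eps0 eps1 etaeps Ha Da.
(* The quadratic summand keeps [h r] positive where the deficit vanishes, and it is [o(r)]. *)
pose h r := deficit F a (2 * r) / eps + eta * r ^+ 2.
pose term r x :=
  Num.max 0 (h r - 8^-1 * Num.max 0 (Num.min (F (a + r) - F x) (F x - F (a - r)))).
pose D := [set r : R | 0 < r <= l].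
pose Phi := supf D term.
have D0 : D !=set0 by exists l; rewrite /D/= l0 lexx.
have q0 : 0 < eta / eps by rewrite divr_gt0.
have q : eta / eps <= 64^-1 by rewrite ler_pdivrMr//; lra.
have h_le r : 0 < r -> r <= l -> h r <= 3 * (eta / eps) * r.
  move=> r0 rl; rewrite /h.
  have : deficit F a (2 * r) / eps <= eta * (2 * r) / eps.
    by rewrite ler_pM2r ?invr_gt0//; apply: Ha; lra.
  have -> : eta * (2 * r) / eps = 2 * (eta / eps) * r by field; rewrite gt_eqF.
  have : eta * r ^+ 2 <= (eta / eps) * r.
    rewrite expr2 mulrA ler_wpM2r ?(ltW r0)//.
    have : eta <= eta / eps by rewrite ler_pdivlMr// ler_piMr// ltW.
    have r1 : r <= 1 by lra.
    by apply: le_trans; rewrite ler_piMr ?(ltW eta0).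
  lra.
have term_ge0 r x : 0 <= term r x by rewrite /term le_max lexx.
have term_le r x : term r x <= Num.max 0 (h r).
  rewrite /term ge_max !le_max lexx/=; apply/orP; right.
  by rewrite gerBl mulr_ge0// ?le_max ?lexx// invr_ge0.
(* The [F]-distance from [x] to either of [a - r] and [a + r] is at least
   [r / 2 - eta * r >= 31/64 * r], and an eighth of this exceeds [h r <= 3/64 * r]. *)
have term_bound r x : 0 < r -> r <= l -> 2 * `|x - a| < r -> term r x = 0.
  move=> r0 rl xr.
  have : `|x - a| <= r by have := normr_ge0 (x - a); lra.
  rewrite ler_distl => /andP[xr1 xr2].
  have := h_le r r0 rl.
  have xa1 : x - a <= `|x - a| by exact: ler_norm.
  have xa2 : a - x <= `|x - a| by rewrite distrC; exact: ler_norm.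
  have d1 : (a + r - x) - (F (a + r) - F x) <= deficit F a r.
    by apply: interval_deficit => //; lra.
  have d2 : (x - (a - r)) - (F x - F (a - r)) <= deficit F a r.
    by apply: interval_deficit => //; lra.
  have := Ha r r0 ltac:(lra) => dr hr.
  have e1 : eta / eps * r <= 64^-1 * r by rewrite ler_pM2r.
  have e2 : eta * r <= 64^-1 * r by rewrite ler_pM2r//; lra.
  apply/eqP; rewrite eq_le term_ge0 andbT /term ge_max lexx/=.
  rewrite subr_le0 -ler_pdivrMl ?invr_gt0// invrK.
  by rewrite le_max; apply/orP; right; rewrite le_min; apply/andP; split; lra.
have term_ub x r : D r -> term r x <= 3 * (eta / eps).
  move=> /andP[r0 rl]; apply: (le_trans (term_le _ _)).
  rewrite ge_max; apply/andP; split; first by lra.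
  apply: (le_trans (h_le r r0 rl)); rewrite ler_piMr//; lra.
(* Only radii [r <= 2 * |x - a|] contribute, so a linear bound on [h] passes to [Phi] with a factor
   2. *)
have Phi_bound x c :
    (forall r, 0 < r -> r <= l -> r <= 2 * `|x - a| -> h r <= c * r) ->
    0 <= c -> Phi x <= c * (2 * `|x - a|).
  move=> hc c0; apply: supf_le => // r /andP[r0 rl].
  have [rx|xr] := leP r (2 * `|x - a|); last first.
    by rewrite term_bound// !mulr_ge0.
  apply: (le_trans (term_le _ _)); rewrite ge_max; apply/andP; split.
    by rewrite !mulr_ge0.
  by apply: (le_trans (hc _ r0 rl rx)); rewrite ler_wpM2l.
have Phi0 x : 0 <= Phi x.
  apply: (le_trans (term_ge0 l x)).
  by apply: (supf_ge (M := 3 * (eta / eps))) => [r|]; [exact: term_ub|rewrite /D/= l0 lexx].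
have Phile x : Phi x <= 6 * (eta / eps) * `|x - a|.
  rewrite (_ : 6 * _ * _ = 3 * (eta / eps) * (2 * `|x - a|)); last by lra.
  by apply: Phi_bound => [r r0 rl _|]; [exact: h_le|lra].
have Phia : Phi a = 0.
  by apply/eqP; rewrite eq_le Phi0 andbT (le_trans (Phile a))// subrr normr0 mulr0.
exists Phi; split => //.
- split => //.
  apply: lipwrt_supf => // [r _|x]; last first.
    by exists (3 * (eta / eps)) => r; exact: term_ub.
  apply: lipwrt_max; first by apply: lipwrt_cst; lra.
  have : lipwrt F 1 (fun x => Num.max 0 (Num.min (F (a + r) - F x) (F x - F (a - r)))).
    apply: lipwrt_max; first exact: lipwrt_cst.
    by apply: lipwrt_min; [exact: lipwrt_subl|exact: lipwrt_subr].
  by move=> Hm; apply: lipwrt_le => x y; have := Hm y x; rewrite mul1r ler_norml distrC; lra.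
- move=> x x0 xl; set u := `|x - a|.
  (* At radius [u] the point [x] is an end of the interval, where nothing is subtracted from
     [h u]. *)
  have hu : h u <= Phi x.
    have Du : D u by rewrite /D/= x0 xl.
    have := supf_ge (@term_ub x) Du; rewrite -/Phi; apply: le_trans.
    rewrite /term le_max; apply/orP; right.
    rewrite (_ : Num.max 0 (Num.min _ _) = 0) ?mulr0 ?subr0//.
    apply/max_idPl; rewrite ge_min; apply/orP.
    have [xa|xa] := leP a x.
      left; rewrite /u ger0_norm ?subr_ge0// (_ : a + (x - a) = x); last by lra.
      by rewrite subrr.
    right; rewrite /u ltr0_norm ?subr_lt0// (_ : a - (- (x - a)) = x); last by lra.
    by rewrite subrr.
  have eu : 0 < eta * u ^+ 2 by rewrite mulr_gt0 ?exprn_gt0.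
  have du : 0 <= deficit F a (2 * u) by rewrite deficit_ge0// mulr_ge0// ltW.
  have du' : 0 <= deficit F a (2 * u) / eps by rewrite divr_ge0// ltW.
  move: hu; rewrite /h => hu; split; first by lra.
  by rewrite -ler_pdivrMl// mulrC; lra.
- move=> c c0.
  (* This constant and the second bound in the minimum below make each summand of [h r] at most
     [c / 4 * r]. *)
  have [d d0 Hd] := Da (c * eps / 8) ltac:(by rewrite divr_gt0// mulr_gt0).
  exists (Num.min (d / 4) (c / (8 * eta))).
    by rewrite lt_min !divr_gt0// mulr_gt0.
  move=> y; rewrite lt_min => /andP[yd yc].
  rewrite Phia subr0 (ger0_norm (Phi0 y)).
  rewrite (_ : c * _ = (c / 2) * (2 * `|y - a|)); last by lra.
  apply: Phi_bound; last by lra.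
  move=> r r0 rl ry; rewrite /h.
  have h1 : deficit F a (2 * r) <= c * eps / 8 * (2 * r) by apply: Hd; lra.
  have h2 : deficit F a (2 * r) / eps <= c / 4 * r.
    by rewrite ler_pdivrMr//; apply: (le_trans h1); lra.
  have h3 : eta * r <= c / 4.
    move: yc; rewrite ltr_pdivlMr ?mulr_gt0// => yc.
    by have := ler_wpM2l (ltW eta0) ry; lra.
  have : eta * r ^+ 2 <= c / 4 * r.
    by rewrite expr2 mulrA ler_wpM2r// ltW.
  lra.
Qed.

End point_function.

(** * Candidates for the next tolerance and their combinations *)

Section admissible.
Context {R : realType}.
Implicit Types (F rho g f : R -> R) (eps kap x y z a b l eta r : R).

(** The fourth clause is uniform in [z] and [y]: in a supremum of candidates with [kap] tending to 0
    it controls all but finitely many members near a zero. The last clause deals with the remaining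
    ones. *)
Definition admissible F rho eps kap g :=
  [/\ forall x, 0 <= g x <= rho x,
      lipwrt F (8^-1) g,
      forall x, deficit F x (g x) <= eps * g x,
      forall z y, g z = 0 -> g y <= kap * `|y - z| &
      forall z, g z = 0 -> flat_at g z].

Lemma admissible0 F rho eps kap : (forall x, 0 <= rho x) -> 0 <= kap ->
  admissible F rho eps kap (fun=> 0).
Proof.
move=> rho0 k0; split => //.
- by move=> x; rewrite lexx rho0.
- by apply: lipwrt_cst; rewrite invr_ge0.
- by move=> x; rewrite deficit0 mulr0.
- by move=> z y _; rewrite mulr_ge0.
- move=> z _ c c0; exists 1 => // y _.
  by rewrite subrr normr0 mulr_ge0// ltW.
Qed.

Lemma max_eq0 x y : 0 <= x -> 0 <= y -> Num.max x y = 0 -> x = 0 /\ y = 0.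
Proof. by rewrite /Num.max; case: ltP => xy x0 y0 xy0; split; lra. Qed.

Lemma admissible_max F rho eps kap g f :
  admissible F rho eps kap g -> admissible F rho eps kap f ->
  admissible F rho eps kap (fun x => Num.max (g x) (f x)).
Proof.
move=> [g1 g2 g3 g4 g5] [f1 f2 f3 f4 f5].
have z0 z : Num.max (g z) (f z) = 0 -> g z = 0 /\ f z = 0.
  by apply: max_eq0; [have := g1 z|have := f1 z]; lra.
split.
- by move=> x; have := g1 x; have := f1 x; rewrite /Num.max; case: ltP => ?; lra.
- exact: lipwrt_max.
- by move=> x; rewrite /Num.max; case: ltP.
- move=> z y /z0[gz fz]; rewrite ge_max.
  by rewrite g4// f4.
- move=> z /z0[gz fz] c c0.
  have [d1 d10 H1] := g5 z gz c c0.
  have [d2 d20 H2] := f5 z fz c c0.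
  exists (Num.min d1 d2); first by rewrite lt_min d10.
  move=> y; rewrite lt_min => /andP[/H1 + /H2].
  rewrite gz fz maxxx !subr0 => h1 h2.
  by rewrite /Num.max; case: ltP.
Qed.

(** Take the minimum of the point functions at [a] and [b], cut off outside the interval. It stays
    below [rho] because it is at most [l], while [rho a >= 2 * l] and [rho] has slope at most 1/8.
    The deficit bound passes from [a] to [x] because the interval of radius [g x <= |x - a|] about
    [x] lies in the one of radius [2 * |x - a|] about [a]; likewise for [b]. *)
Lemma admissible_pair F rho eps kap a b l eta :
  nonexp F -> (forall x, 0 <= rho x) -> lipwrt F (8^-1) rho ->
  0 < eps -> eps <= 1 -> 0 < eta -> 64 * eta <= eps ->
  6 * (eta / eps) <= kap -> kap <= 1 ->
  0 < l -> l <= 1 -> 2 * l <= rho a -> a < b -> b - a <= l ->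
  (forall r, 0 < r -> r <= 2 * l -> deficit F a r <= eta * r) ->
  (forall r, 0 < r -> r <= 2 * l -> deficit F b r <= eta * r) ->
  density_at F a -> density_at F b ->
  exists2 g, admissible F rho eps kap g & forall x, a < x -> x < b -> 0 < g x.
Proof.
move=> HF rho0 rhoL eps0 eps1 eta0 etaeps etak k1 l0 l1 rhoa ab bal Ha Hb Da Db.
have [A [[A0 AL Aa] A1 A2 A3]] := point_function HF l0 l1 eta0 eps0 eps1 etaeps Ha Da.
have [B [[B0 BL Bb] B1 B2 B3]] := point_function HF l0 l1 eta0 eps0 eps1 etaeps Hb Db.
have Ak x : A x <= kap * `|x - a|.
  by apply: (le_trans (A2 x)); rewrite ler_wpM2r.
have Bk x : B x <= kap * `|x - b|.
  by apply: (le_trans (B2 x)); rewrite ler_wpM2r.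
have kap0 : 0 < kap.
  by apply: (lt_le_trans _ etak); rewrite mulr_gt0// divr_gt0.
pose g x := if (a < x) && (x < b) then Num.min (A x) (B x) else 0.
have gin x : a < x -> x < b -> g x = Num.min (A x) (B x) by rewrite /g => -> ->.
have gout x : x <= a \/ b <= x -> g x = 0.
  by move=> [xa|bx]; rewrite /g; [rewrite ltNge xa|rewrite [x < b]ltNge bx andbF].
have gA x : g x <= A x by rewrite /g; case: ifP => // _; rewrite ge_min lexx.
have gB x : g x <= B x by rewrite /g; case: ifP => // _; rewrite ge_min lexx orbT.
have g0 x : 0 <= g x by rewrite /g; case: ifP => // _; rewrite le_min A0 B0.
have gpos x : a < x -> x < b -> 0 < g x.
  move=> ax xb; rewrite gin// lt_min; apply/andP; split.
    by apply A1; rewrite gtr0_norm; lra.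
  by apply B1; rewrite distrC gtr0_norm; lra.
have zout z : g z = 0 -> z <= a \/ b <= z.
  move=> gz; have [za|az] := leP z a; first by left.
  have [bz|zb] := leP b z; first by right.
  by have := gpos z az zb; rewrite gz ltxx.
have cases x : (x <= a \/ b <= x) \/ (a < x /\ x < b).
  have [xa|ax] := leP x a; first by left; left.
  have [bx|xb] := leP b x; first by left; right.
  by right.
(* A zero outside the open interval is separated from [y] by [a] or [b], so bounds in terms of the
   end points become bounds in terms of [z]. *)
have dist z y : g z = 0 -> a < y -> y < b ->
    (`|y - a| <= `|y - z|) \/ (`|y - b| <= `|y - z|).
  move=> /zout[za|bz] ay yb; [left|right].
    by rewrite !ger0_norm//; lra.
  by rewrite distrC (distrC y z) !ger0_norm//; lra.
exists g => //; split => //.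
- move=> x; rewrite g0/=; have [/gout ->//|[ax xb]] := cases x.
  have xa : `|x - a| = x - a by rewrite gtr0_norm//; lra.
  apply: (le_trans (gA x)); apply: (le_trans (Ak x)).
  have e8 : 0 <= 8^-1 :> R by rewrite invr_ge0.
  have := lipwrt_dist HF e8 rhoL a x.
  rewrite ler_norml (distrC a) xa => /andP[_ h].
  by have : kap * (x - a) <= 1 * (x - a); [rewrite ler_wpM2r//; lra|lra].
- apply: lipwrt_le => x y.
  have Fxy : 0 <= 8^-1 * `|F x - F y| by rewrite mulr_ge0// invr_ge0.
  have [/gout ->|[ax xb]] := cases x; first by have := g0 y; lra.
  have [yout|[ay yb]] := cases y; last first.
    rewrite !gin//; have := lipwrt_min AL BL x y.
    by rewrite ler_norml => /andP[_]; apply: le_trans.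
  rewrite (gout y yout) subr0; case: yout => [ya|by_].
    apply: (le_trans (gA x)); have := AL x a; rewrite Aa subr0 ler_norml => /andP[_].
    move/le_trans; apply; rewrite ler_wpM2l ?invr_ge0//.
    have := nonexp_le HF (ltW ax); have := nonexp_le HF ya => h1 h2.
    by rewrite !ger0_norm//; lra.
  apply: (le_trans (gB x)); have := BL x b; rewrite Bb subr0 ler_norml => /andP[_].
  move/le_trans; apply; rewrite ler_wpM2l ?invr_ge0//.
  have := nonexp_le HF (ltW xb); have := nonexp_le HF by_ => h1 h2.
  by rewrite distrC (distrC (F x)) !ger0_norm//; lra.
- move=> x; have [/gout ->|[ax xb]] := cases x; first by rewrite deficit0 mulr0.
  have gxa : g x <= x - a.
    apply: (le_trans (gA x)); apply: (le_trans (Ak x)).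
    by rewrite gtr0_norm ?subr_gt0// ler_piMl// subr_ge0 ltW.
  have gxb : g x <= b - x.
    apply: (le_trans (gB x)); apply: (le_trans (Bk x)).
    by rewrite distrC gtr0_norm ?subr_gt0// ler_piMl// subr_ge0 ltW.
  have [||_ dA] := A1 x; [by rewrite gtr0_norm; lra|by rewrite gtr0_norm; lra|].
  have [||_ dB] := B1 x; [by rewrite distrC gtr0_norm; lra|by rewrite distrC gtr0_norm; lra|].
  rewrite -ler_pdivrMl// gin// le_min !ler_pdivrMl// -gin//; apply/andP; split.
    apply: le_trans dA; rewrite gtr0_norm ?subr_gt0//.
    by apply: deficit_sub => //; lra.
  apply: le_trans dB; rewrite distrC gtr0_norm ?subr_gt0//.
  by apply: deficit_sub => //; lra.
- move=> z y gz; have [/gout ->|[ay yb]] := cases y; first by rewrite mulr_ge0// ltW.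
  have [d|d] := dist z y gz ay yb.
    by apply: (le_trans (gA y)); apply: (le_trans (Ak y)); rewrite ler_pM2l.
  by apply: (le_trans (gB y)); apply: (le_trans (Bk y)); rewrite ler_pM2l.
- move=> z gz c c0.
  have [d1 d10 H1] := A3 c c0; have [d2 d20 H2] := B3 c c0.
  exists (Num.min d1 d2); first by rewrite lt_min d10.
  move=> y; rewrite lt_min => /andP[yd1 yd2].
  rewrite gz subr0 ger0_norm//.
  have [/gout ->|[ay yb]] := cases y; first by rewrite mulr_ge0// ltW.
  have [d|d] := dist z y gz ay yb.
    apply: (le_trans (gA y)); have := H1 y (le_lt_trans d yd1).
    by rewrite Aa subr0 ger0_norm// => /le_trans; apply; rewrite ler_pM2l.
  apply: (le_trans (gB y)); have := H2 y (le_lt_trans d yd2).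
  by rewrite Bb subr0 ger0_norm// => /le_trans; apply; rewrite ler_pM2l.
Qed.

(** The deficit bound survives the supremum because changing the radius by [s] changes the deficit
    by at most [2 * s]. For flatness with constant [c], the members with [1 / (m + 1) < c] obey the
    bound everywhere, and the finitely many others obey it near [z]. *)
Lemma admissible_supf F rho eps (g : nat -> R -> R) : nonexp F -> 0 <= eps ->
  (forall x, 0 <= rho x) ->
  (forall m, admissible F rho eps m.+1%:R^-1 (g m)) ->
  let rho' := supf setT g in
  [/\ forall x, 0 <= rho' x <= rho x,
      lipwrt F (8^-1) rho',
      forall x, deficit F x (rho' x) <= eps * rho' x,
      forall z, rho' z = 0 -> flat_at rho' z &
      forall z, rho' z = 0 -> forall m, g m z = 0].
Proof.
move=> HF eps0 rho0 gA rho'.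
have gub x m : setT m -> g m x <= rho x by move=> _; have [/(_ x)/andP[]] := gA m.
have g0 x m : 0 <= g m x by have [/(_ x)/andP[]] := gA m.
have gle x m : g m x <= rho' x by exact: (supf_ge (gub x)).
have D0 : [set: nat] !=set0 by exists 0%N.
have rho'0 x : 0 <= rho' x by apply: le_trans (gle x 0%N).
have rho'z z : rho' z = 0 -> forall m, g m z = 0.
  by move=> z0 m; apply/eqP; rewrite eq_le g0 andbT -z0.
split => //.
- by move=> x; rewrite rho'0; apply: supf_le => // m; exact: gub.
- apply: lipwrt_supf => // [m _|x]; first by case: (gA m).
  by exists (rho x); exact: gub.
- move=> x; apply/ler_addgt0Pr => e e0.
  have e20 : 0 < e / 2 by rewrite divr_gt0.
  have [m _ gm] := supf_adherent D0 (gub x) e20.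
  have [_ _ /(_ x) dm _ _] := gA m.
  have h1 : deficit F x (rho' x) <= deficit F x (g m x) + 2 * (rho' x - g m x).
    have h := gle x m.
    have i1 : F (x + g m x) <= F (x + rho' x) by apply: nonexp_le => //; lra.
    have i2 : F (x - rho' x) <= F (x - g m x) by apply: nonexp_le => //; lra.
    by rewrite /deficit; lra.
  have h2 : eps * g m x <= eps * rho' x by rewrite ler_wpM2l.
  by move: gm; rewrite -/rho'; lra.
- move=> z /[dup] rz /rho'z gz c c0.
  have [N] : exists N : nat, N.+1%:R^-1 < c.
    by near \oo => N; exists N; near: N; exact: near_infty_natSinv_lt (PosNum c0).
  move=> Nc.
  have [d d0 Hd] : exists2 d, 0 < d & forall m y, (m < N)%N -> `|y - z| < d ->
      g m y <= c * `|y - z|.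
    elim: N {Nc} => [|N [d d0 Hd]]; first by exists 1.
    have [_ _ _ _ /(_ z (gz N) c c0)[d' d'0 Hd']] := gA N.
    exists (Num.min d d'); first by rewrite lt_min d0.
    move=> m y; rewrite ltnS leq_eqVlt lt_min => /orP[/eqP->|mN] /andP[yd yd'].
      by have := Hd' y yd'; rewrite gz subr0 ger0_norm.
    exact: Hd.
  exists d => // y yd; rewrite rz subr0 ger0_norm//.
  apply: supf_le => // m _; have [mN|Nm] := ltnP m N; first exact: Hd.
  have [_ _ _ /(_ z y (gz m)) h _] := gA m.
  apply: (le_trans h); rewrite ler_wpM2r//.
  apply: (le_trans _ (ltW Nc)); rewrite lef_pV2 ?posrE//.
  by rewrite ler_nat ltnS.
Unshelve. all: by end_near. Qed.

End admissible.

(** * Distribution functions and density *)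

Section distribution.
Context {R : realType}.
Local Notation mu := (@lebesgue_measure R).
Implicit Types (A B : set R) (x y z r c d t : R) (F : R -> R).

Definition distribution_of A F :=
  forall x y, x <= y -> mu (A `&` `]x, y]) = (F y - F x)%:E.

Lemma lebesgue_measure_oc x y : x <= y -> mu `]x, y]%classic = (y - x)%:E.
Proof.
rewrite le_eqVlt => /orP[/eqP->|xy].
  by rewrite set_itvoc0 measure0 subrr.
by rewrite lebesgue_measure_itv/= lte_fin xy EFinB.
Qed.

Lemma measureI_oc_le A x y : measurable A -> x <= y ->
  (mu (A `&` `]x, y]) <= (y - x)%:E)%E.
Proof.
move=> mA xy; rewrite -lebesgue_measure_oc//.
by apply: measureIr.
Qed.

Lemma distribution_nonexp A F : measurable A -> distribution_of A F -> nonexp F.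
Proof.
move=> mA AF x y xy; have := measureI_oc_le mA xy.
by rewrite AF// lee_fin => ->; rewrite -lee_fin -AF// measure_ge0.
Qed.

Lemma distribution_exists A : measurable A -> exists F, distribution_of A F.
Proof.
move=> mA; pose m x y := fine (mu (A `&` `]x, y])).
have fin x y : mu (A `&` `]x, y]) \is a fin_num.
  have [xy|yx] := leP x y.
    by rewrite ge0_fin_numE// (le_lt_trans (measureI_oc_le mA xy))// ltry.
  by rewrite set_itv_ge ?setI0 ?measure0// bnd_simp -leNgt ltW.
have mE x y : mu (A `&` `]x, y]) = (m x y)%:E by rewrite fineK.
have m0 x y : y <= x -> m x y = 0.
  by move=> yx; rewrite /m set_itv_ge ?setI0 ?measure0// bnd_simp -leNgt.
have mD x y z : x <= y -> y <= z -> m x z = m x y + m y z.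
  move=> xy yz; apply: EFin_inj; rewrite EFinD -!mE.
  rewrite -measureU//; [|exact: measurableI|exact: measurableI|].
    by rewrite -setIUr -itv_bndbnd_setU ?bnd_simp.
  apply/seteqP; split => // t []/= [_]; rewrite in_itv/= => /andP[_ ty].
  by move=> [_]; rewrite in_itv/= ltNge ty.
(* The signed primitive based at 0: since [m x y] vanishes for [y <= x], only one of the two terms
   is present on each side of 0. *)
exists (fun x => m 0 x - m x 0) => x y xy; rewrite mE; congr EFin.
have [x0|x0] := leP 0 x.
  by rewrite (m0 x 0)// (m0 y 0) ?(le_trans x0)// (mD 0 x y)//; lra.
have [y0|y0] := leP 0 y.
  by rewrite (m0 y 0)// (m0 0 x) ?(ltW x0)// (mD x 0 y)// ?(ltW x0)//; lra.
by rewrite (m0 0 y) ?(m0 0 x) ?(ltW y0) ?(ltW x0)// (mD x y 0) ?(ltW y0)//; lra.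
Qed.

Lemma distribution_density A F : measurable A -> distribution_of A F ->
  mu.-negligible [set x | A x /\ ~ density_at F x].
Proof.
move=> mA AF; have := lebesgue_density mA.
rewrite /almost_everywhere; apply: negligibleS => /= x [Ax nd] H; apply: nd.
move=> c c0.
have {H} : (fun r => fine (mu (A `&` ball x r) * (mu (ball x r))^-1)%E) @ 0^'+ --> (1 : R).
  by apply: fine_cvg; move: H => /=; rewrite indicE mem_set.
(* The ball has measure [2 * r], so missing a fraction [c / 2] of it means a deficit of [c * r]. *)
move/(cvgr_gt 1)/(_ (1 - c / 2) ltac:(lra)).
case=> d /= d0 Hd.
exists d => // r r0 rd.
have := Hd r; rewrite /= sub0r normrN gtr0_norm// => /(_ rd r0).
have r2 : r *+ 2 != 0 by rewrite mulrn_eq0/= gt_eqF.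
have fin : mu (A `&` ball x r) \is a fin_num.
  rewrite ge0_fin_numE//; apply: (@le_lt_trans _ _ (mu (ball x r))).
    by apply: measureIr => //; by rewrite ball_itv.
  by rewrite lebesgue_measure_ball ?ltW// ltry.
rewrite lebesgue_measure_ball ?(ltW r0)// inver (negbTE r2) fineM//= => h.
have : fine (mu (A `&` ball x r)) <= F (x + r) - F (x - r).
  rewrite -lee_fin fineK// -AF; last by lra.
  apply: le_measure; rewrite ?inE; [| |].
  - by apply: measurableI => //; by rewrite ball_itv.
  - exact: measurableI.
  - apply: setIS; rewrite ball_itv; exact: subset_itv_oo_oc.
move: h; rewrite ltr_pdivlMr; last by rewrite mulrn_wgt0.
by rewrite /deficit -mulr_natr; lra.
Qed.

Lemma distribution_thin A F : measurable A -> distribution_of A F ->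
  mu.-negligible [set x | ~ A x /\ ~ (forall c, 0 < c -> exists2 d, 0 < d &
    forall r, 0 < r -> r < d -> F (x + r) - F (x - r) <= c * r)].
Proof.
move=> mA AF; have := lebesgue_density mA.
rewrite /almost_everywhere; apply: negligibleS => /= x [Ax nd] H; apply: nd.
move=> c c0.
have {H} : (fun r => fine (mu (A `&` ball x r) * (mu (ball x r))^-1)%E) @ 0^'+ --> (0 : R).
  by apply: fine_cvg; move: H => /=; rewrite indicE memNset.
move/(cvgr_lt 0)/(_ (c / 4) ltac:(lra)).
case=> d /= d0 Hd.
exists (d / 2); first by lra.
(* The increment of [F] measures a half-open interval, which the open ball of radius [r] does not
   contain. The ball of radius [2 * r] does; its measure [4 * r] explains the threshold [c / 4]. *)
move=> r r0 rd; pose s := 2 * r.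
have s0 : 0 < s by rewrite /s; lra.
have := Hd s; rewrite /= sub0r normrN gtr0_norm// => /(_ ltac:(rewrite /s; lra) s0).
have r2 : s *+ 2 != 0 by rewrite mulrn_eq0/= gt_eqF.
have fin : mu (A `&` ball x s) \is a fin_num.
  rewrite ge0_fin_numE//; apply: (@le_lt_trans _ _ (mu (ball x s))).
    by apply: measureIr => //; by rewrite ball_itv.
  by rewrite lebesgue_measure_ball ?ltW// ltry.
rewrite lebesgue_measure_ball ?(ltW s0)// inver (negbTE r2) fineM//= => h.
have : F (x + r) - F (x - r) <= fine (mu (A `&` ball x s)).
  rewrite -lee_fin fineK// -AF; last by lra.
  apply: le_measure; rewrite ?inE; [| |].
  - exact: measurableI.
  - by apply: measurableI => //; by rewrite ball_itv.
  - apply: setIS; rewrite ball_itv => t/=; rewrite !in_itv/= /s; lra.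
move: h; rewrite ltr_pdivrMr; last by rewrite mulrn_wgt0.
by rewrite /s -mulr_natr; lra.
Qed.

Lemma small_tail (B : nat -> set R) (t : R) : (forall k, measurable (B k)) ->
  (mu (B 0%N) < +oo)%E -> nonincreasing_seq B -> mu (\bigcap_k B k) = 0%E ->
  0 < t -> exists k, (mu (B k) <= t%:E)%E.
Proof.
move=> mB B0 dB muB t0.
have : mu \o B @ \oo --> mu (\bigcap_k B k).
  by apply: nonincreasing_cvg_mu => //; exact: bigcapT_measurable.
rewrite muB => /fine_cvg /(cvgr_lt 0)/(_ t t0) [k _ /(_ k (leqnn k))/= h].
exists k; rewrite -[leLHS]fineK ?lee_fin ?ltW// ge0_fin_numE//.
rewrite (le_lt_trans _ B0)//; apply: le_measure; rewrite ?inE; [exact: mB|exact: mB|].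
by have /subsetPset := dB 0%N k (leq0n k).
Qed.

Lemma lipwrt_continuous F (g : R -> R) c : nonexp F -> 0 <= c ->
  lipwrt F c g -> continuous g.
Proof.
move=> HF c0 gL x; apply/cvgrPdist_le => e e0; near=> y.
apply: (le_trans (lipwrt_dist HF c0 gL x y)).
apply: (@le_trans _ _ ((c + 1) * `|x - y|)); first by rewrite ler_wpM2r//; lra.
rewrite -ler_pdivlMl; last by lra.
by near: y; apply: cvgr_dist_le => //; rewrite mulr_gt0// invr_gt0; lra.
Unshelve. all: by end_near. Qed.

Lemma nonexp_continuous F : nonexp F -> continuous F.
Proof.
by move=> HF; apply: (lipwrt_continuous HF ler01) => x y; rewrite mul1r.
Qed.

Lemma small_sublevel A (g : R -> R) (t : R) : measurable A -> (mu A < +oo)%E ->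
  continuous g -> (forall x, 0 <= g x) -> mu (A `&` [set x | g x = 0]) = 0%E ->
  0 < t -> exists2 d, 0 < d & (mu (A `&` [set x | (g x < d)%R]) <= t%:E)%E.
Proof.
move=> mA Afin cg g0 muA t0.
have mg d : measurable [set x | g x < d].
  by apply: open_measurable; apply: open_comp (@open_lt _ d) => x _; exact: cg.
have [|||||k Hk] := @small_tail (fun k => A `&` [set x | g x < k.+1%:R^-1]) t.
- by move=> k; exact: measurableI.
- by apply: le_lt_trans Afin; apply: measureIl => //; exact: mg.
- move=> m n mn; apply/subsetPset; apply: setIS => x/= /lt_le_trans; apply.
  by rewrite lef_pV2 ?posrE// ler_nat.
- rewrite -muA; congr (mu _); apply/seteqP; split => x/=.
    move=> H; split; first by have [] := H 0%N I.
    apply/eqP; rewrite eq_le g0 andbT; apply/ler_addgt0Pr => e e0; rewrite add0r.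
    near \oo => k; have [_/= h] := H k I.
    apply: (le_trans (ltW h)); apply/ltW; near: k.
    exact: near_infty_natSinv_lt (PosNum e0).
  by move=> [Ax gx] k _; split=> //=; rewrite gx invr_gt0.
- exact: t0.
- by exists k.+1%:R^-1.
Unshelve. all: by end_near. Qed.

End distribution.

(** * Scales at which the set is dense *)

Section key.
Context {R : realType}.
Local Notation mu := (@lebesgue_measure R).
Implicit Types (E A B : set R) (x y z r c d t M a b l eps kap eta : R) (F rho g : R -> R).

Lemma lebesgue_measure_cc x y : x <= y -> mu `[x, y]%classic = (y - x)%:E.
Proof.
rewrite le_eqVlt => /orP[/eqP->|xy].
  by rewrite set_itv1 lebesgue_measure_set1 subrr.
by rewrite lebesgue_measure_itv/= lte_fin xy EFinB.
Qed.

Lemma le_measure_sub A B : measurable A -> measurable B -> A `<=` B ->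
  (mu A <= mu B)%E.
Proof. by move=> mA mB AB; apply: le_measure; rewrite ?inE. Qed.

Lemma le_lebesgue_measureU A B : measurable A -> measurable B ->
  (mu (A `|` B) <= mu A + mu B)%E.
Proof. move=> mA mB; exact: (@measureU2 _ _ _ mu). Qed.

Lemma closed_zero g : continuous g -> closed [set x | g x = 0].
Proof.
move=> cg; rewrite (_ : [set _ | _] = g @^-1` [set 0]); last by apply/seteqP; split.
by apply: closed_comp => [x _|]; [exact: cg|exact: closed_eq].
Qed.

Lemma open_pos g : continuous g -> open [set x | 0 < g x].
Proof. by move=> cg; apply: open_comp (@open_gt _ 0) => x _; exact: cg. Qed.

Lemma admissible_continuous F rho eps kap g : nonexp F ->
  admissible F rho eps kap g -> continuous g.
Proof.
move=> HF [_ gL _ _ _]; apply: lipwrt_continuous HF _ gL.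
by rewrite invr_ge0.
Qed.

(** Any two points of [T] in the cell can serve as end points for [admissible_pair]. Choosing them
    almost extremal leaves only two short pieces of [T] uncovered. *)
Lemma admissible_cell F rho eps kap (T : set R) c l t eta :
  nonexp F -> (forall x, 0 <= rho x) -> lipwrt F (8^-1) rho ->
  0 < eps -> eps <= 1 -> 0 < kap -> kap <= 1 -> 0 < eta ->
  64 * eta <= eps -> 6 * (eta / eps) <= kap ->
  0 < l -> l <= 1 -> 0 < t -> measurable T ->
  (forall x, T x -> [/\ 2 * l <= rho x, density_at F x &
     forall r, 0 < r -> r <= 2 * l -> deficit F x r <= eta * r]) ->
  exists2 g, admissible F rho eps kap g &
    (mu (T `&` `]c, (c + l)%R] `&` [set x | g x = 0%R]) <= t%:E)%E.
Proof.
move=> HF rho0 rhoL eps0 eps1 kap0 kap1 eta0 etaeps etak l0 l1 t0 mT HT.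
pose T' := T `&` `]c, (c + l)].
have mT' : measurable T' by exact: measurableI.
have adm0 := @admissible0 _ F rho eps kap rho0 (ltW kap0).
have [T'0|/set0P T'0] := eqVneq T' set0.
  by exists (fun=> 0) => //; rewrite -/T' T'0 set0I measure0 lee_fin ltW.
have T'c x : T' x -> c < x /\ x <= c + l.
  by move=> [_/=]; rewrite in_itv/= => /andP.
have lbT' : has_lbound T' by exists c => x /T'c; lra.
have ubT' : has_ubound T' by exists (c + l) => x /T'c; lra.
have t20 : 0 < t / 2 by rewrite divr_gt0.
have [a T'a aa] := inf_adherent t20 (conj T'0 lbT').
have [b T'b bb] := sup_adherent t20 (conj T'0 ubT').
have inf_le x : T' x -> inf T' <= x by move=> T'x; exact: ge_inf.
have le_sup' x : T' x -> x <= sup T' by move=> T'x; exact: ub_le_sup.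
suff [g gA Hg] : exists2 g, admissible F rho eps kap g &
    forall x, T' x -> g x = 0 -> x <= a \/ b <= x.
  exists g => //; rewrite -/T'.
  apply: (@le_trans _ _ (mu (`[inf T', a] `|` `[b, sup T']))).
    apply: le_measure_sub.
    - apply: measurableI => //; apply: closed_measurable; apply: closed_zero.
      exact: admissible_continuous gA.
    - exact: measurableU.
    - move=> x [T'x /(Hg _ T'x)[xa|bx]]; [left|right] => /=; rewrite in_itv/=.
        by rewrite inf_le.
      by rewrite bx le_sup'.
  apply: (le_trans (le_lebesgue_measureU _ _)) => //.
  rewrite !lebesgue_measure_cc ?inf_le ?le_sup'//.
  by rewrite -EFinD lee_fin; lra.
(* If [b <= a], every point is on the left of [a] or on the right of [b], and the zero function will
   do. *)
have [ab|ba] := ltP a b; last first.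
  exists (fun=> 0) => // x _ _; have [xa|ax] := leP x a; first by left.
  by right; lra.
have [rhoa Da Ha] := HT _ T'a.1; have [_ Db Hb] := HT _ T'b.1.
have bal : b - a <= l by have := T'c _ T'a; have := T'c _ T'b; lra.
have [g gA gpos] := admissible_pair HF rho0 rhoL eps0 eps1 eta0 etaeps etak kap1
  l0 l1 rhoa ab bal Ha Hb Da Db.
exists g => // x _ gx; have [xa|ax] := leP x a; first by left.
have [bx|xb] := leP b x; first by right.
by have := gpos x ax xb; rewrite gx ltxx.
Qed.

(** Cells are added one at a time; a zero of a maximum is a common zero, so a cell once covered
    stays covered. *)
Lemma admissible_grid F rho eps kap (T : set R) c l t eta (n : nat) :
  nonexp F -> (forall x, 0 <= rho x) -> lipwrt F (8^-1) rho ->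
  0 < eps -> eps <= 1 -> 0 < kap -> kap <= 1 -> 0 < eta ->
  64 * eta <= eps -> 6 * (eta / eps) <= kap ->
  0 < l -> l <= 1 -> 0 < t -> measurable T ->
  (forall x, T x -> [/\ 2 * l <= rho x, density_at F x &
     forall r, 0 < r -> r <= 2 * l -> deficit F x r <= eta * r]) ->
  exists2 g, admissible F rho eps kap g &
    (mu (T `&` `]c, (c + n%:R * l)%R] `&` [set x | g x = 0%R]) <= (n%:R * t)%:E)%E.
Proof.
move=> HF rho0 rhoL eps0 eps1 kap0 kap1 eta0 etaeps etak l0 l1 t0 mT HT.
elim: n => [|n [g gA Hg]].
  exists (fun=> 0); first by apply: admissible0 => //; exact: ltW.
  by rewrite !mul0r addr0 set_itvoc0 setI0 set0I measure0.
have [f fA Hf] := admissible_cell (c + n%:R * l) HF rho0 rhoL eps0 eps1 kap0 kap1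
  eta0 etaeps etak l0 l1 t0 mT HT.
have mz h : admissible F rho eps kap h -> measurable [set x | h x = 0].
  by move=> hA; apply: closed_measurable; apply: closed_zero; exact: admissible_continuous hA.
have gfA := admissible_max gA fA.
exists (fun x => Num.max (g x) (f x)) => //.
apply: (@le_trans _ _ (mu ((T `&` `]c, (c + n%:R * l)%R] `&` [set x | g x = 0%R]) `|`
  (T `&` `](c + n%:R * l)%R, (c + n%:R * l + l)%R] `&` [set x | f x = 0%R])))).
  apply: le_measure_sub.
  - by apply: measurableI; [exact: measurableI|exact: mz].
  - by apply: measurableU; apply: measurableI; [exact: measurableI|exact: mz|exact: measurableI|exact: mz].
  - move=> x [[Tx /=]]; rewrite in_itv/= => /andP[cx xc] gf0.
    have [g1 _ _ _ _] := gA; have [f1 _ _ _ _] := fA.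
    have [//||gx fx] := max_eq0 _ _ gf0.
    - by have /andP[] := g1 x.
    - by have /andP[] := f1 x.
    have [xn|nx] := leP x (c + n%:R * l); [left|right]; split => //; split => //=.
      by rewrite in_itv/= cx.
    by rewrite in_itv/= nx/=; move: xc; rewrite -natr1; lra.
apply: (le_trans (le_lebesgue_measureU _ _)).
- by apply: measurableI; [exact: measurableI|exact: mz].
- by apply: measurableI; [exact: measurableI|exact: mz].
by rewrite -natr1 mulrDl mul1r EFinD; exact: leeD.
Qed.

(** Density holds at some positive scale at almost every point, but the scale depends on the point.
    A single [l k] serves outside a set of measure [t / 2]; the other [t / 2] is distributed over
    the cells of length [l k]. *)
Lemma admissible_cover E F rho eps kap M t :
  measurable E -> distribution_of E F ->
  (forall x, 0 <= rho x) -> lipwrt F (8^-1) rho ->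
  0 < eps -> eps <= 1 -> 0 < kap -> kap <= 1 -> 0 < t ->
  exists2 g, admissible F rho eps kap g &
    (mu (E `&` [set x | (0 < rho x)%R] `&` `](- M)%R, M] `&` [set x | g x = 0%R]) <= t%:E)%E.
Proof.
move=> mE EF rho0 rhoL eps0 eps1 kap0 kap1 t0.
have HF := distribution_nonexp mE EF.
(* Small enough for both [64 * eta <= eps] and [6 * (eta / eps) <= kap]. *)
pose eta := kap * eps / 64.
have eta0 : 0 < eta by rewrite divr_gt0// mulr_gt0.
have etaeps : 64 * eta <= eps.
  have : kap * eps <= 1 * eps by rewrite ler_pM2r.
  by rewrite /eta; lra.
have etak : 6 * (eta / eps) <= kap.
  rewrite (_ : eta / eps = kap / 64); first by lra.
  by rewrite /eta; field; rewrite gt_eqF.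
have crho : continuous rho by apply: lipwrt_continuous HF _ rhoL; rewrite invr_ge0.
have [N [mN N0 subN]] := distribution_density mE EF.
pose S := E `&` [set x | 0 < rho x] `&` `](- M)%R, M].
have mS : measurable S.
  by apply: measurableI => //; apply: measurableI => //; apply: open_measurable; exact: open_pos.
have Sfin : (mu S < +oo)%E.
  apply: (@le_lt_trans _ _ (mu `](- M)%R, M]%classic)); first by apply: le_measure_sub => // x [].
  by rewrite lebesgue_measure_itv/=; case: ifP => _; rewrite ?ltry.
pose l (k : nat) : R := k.+1%:R^-1.
have l0 k : 0 < l k by rewrite /l invr_gt0.
have l1 k : l k <= 1 by rewrite /l invf_le1// ler1n.
have lmono m n : (m <= n)%N -> l n <= l m.
  by move=> mn; rewrite /l lef_pV2 ?posrE// ler_nat.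
(* The points usable as end points at length [l k]. The set is closed, as an intersection of closed
   conditions over all radii, hence measurable. *)
pose C k := [set x | 2 * l k <= rho x] `&`
  \bigcap_(r in [set r | 0 < r <= 2 * l k]) [set x | deficit F x r <= eta * r].
have cF := nonexp_continuous HF.
have mC k : measurable (C k).
  apply: closed_measurable; apply: closedI.
    by apply: closed_comp (@closed_ge _ (2 * l k)) => x _; exact: crho.
  apply: closed_bigI => r _.
  apply: (@closed_comp _ _ (fun x => deficit F x r)) (@closed_le _ (eta * r)) => x _.
  apply: cvgB; first exact: cvg_cst.
  apply: cvgB; (apply: continuous_comp; last exact: cF).
    by apply: cvgD; [exact: cvg_id|exact: cvg_cst].
  by apply: cvgB; [exact: cvg_id|exact: cvg_cst].
have t20 : 0 < t / 2 by rewrite divr_gt0.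
(* By the density theorem almost every point of [S] lies in some [C k], so the sets [S \ C k]
   decrease to a null set. *)
have [|||||k Hk] := @small_tail R (fun k => S `\` C k) (t / 2).
- by move=> k; apply: measurableD.
- by apply: le_lt_trans Sfin; apply: le_measure_sub => //; exact: measurableD.
- move=> m n mn; apply/subsetPset => x [Sx nCx]; split => // -[h1 h2]; apply: nCx.
  have := lmono _ _ mn => lmn; split => /=; first by move: h1 => /=; lra.
  by move=> r /= /andP[r0 rn]; apply: h2 => /=; rewrite r0/=; lra.
- apply/eqP; rewrite -measure_le0 -N0; apply: le_measure_sub => //.
    by apply: bigcapT_measurable => k; exact: measurableD.
  move=> x H; apply: subN; have [Sx _] := H 0%N I; split; first by have [[]] := Sx.
  move=> /(_ eta eta0)[d d0 Hd].
  have rx : 0 < rho x by have [[]] := Sx.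
  have m0 : 0 < Num.min (d / 2) (rho x / 2) by rewrite lt_min !divr_gt0.
  have [k kd] : exists k, l k < Num.min (d / 2) (rho x / 2).
    by near \oo => k; exists k; near: k; exact: near_infty_natSinv_lt (PosNum m0).
  move: kd; rewrite lt_min => /andP[kd kr].
  have [_] := H k I; apply; split => /=; first by lra.
  by move=> r /= /andP[r0 rn]; apply: Hd => //; lra.
- exact: t20.
pose T := (S `&` C k) `\` N.
have mT : measurable T by apply: measurableD => //; exact: measurableI.
have HT x : T x -> [/\ 2 * l k <= rho x, density_at F x &
    forall r, 0 < r -> r <= 2 * l k -> deficit F x r <= eta * r].
  move=> [[[[Ex _] _] [rx Cx]] Nx]; split => //.
    by apply: contrapT => nd; apply: Nx; exact: subN.
  by move=> r r0 rn; apply: Cx => /=; rewrite r0.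
have [n Hn] : exists n : nat, 2 * M <= n%:R * l k.
  near \oo => n; exists n; rewrite -ler_pdivrMr//.
  by near: n; exact: nbhs_infty_ger.
(* The successor keeps the quotient positive when [n = 0]. *)
have t'0 : 0 < t / 2 / n.+1%:R by rewrite divr_gt0.
have [g gA Hg] := admissible_grid (-M) n HF rho0 rhoL eps0 eps1 kap0 kap1
  eta0 etaeps etak (l0 k) (l1 k) t'0 mT HT.
have mg : measurable [set x | g x = 0].
  by apply: closed_measurable; apply: closed_zero; exact: admissible_continuous gA.
exists g => //; rewrite -/S.
apply: (@le_trans _ _ (mu (((S `\` C k) `|` N) `|`
  (T `&` `](- M)%R, (- M + n%:R * l k)%R] `&` [set x | g x = 0%R])))).
  apply: le_measure_sub.
  - exact: measurableI.
  - apply: measurableU; first by apply: measurableU => //; exact: measurableD.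
    by apply: measurableI => //; exact: measurableI.
  - move=> x [Sx gx]; have [Nx|Nx] := pselect (N x); first by left; right.
    have [Cx|Cx] := pselect (C k x); last by left; left.
    right; split => //; split => //=.
    case: (Sx) => _ /=; rewrite !in_itv/= => /andP[-> xM] /=; lra.
apply: (le_trans (le_lebesgue_measureU _ _)).
- by apply: measurableU => //; exact: measurableD.
- by apply: measurableI => //; exact: measurableI.
rewrite (_ : t = t / 2 + t / 2); last by lra.
rewrite EFinD; apply: leeD.
  by apply: (le_trans (le_lebesgue_measureU _ _)) => //; [exact: measurableD|rewrite N0 adde0].
apply: (le_trans Hg); rewrite lee_fin mulrCA ler_piMr ?(ltW t20)//.
by rewrite ler_pdivrMr// mul1r ler_nat.
Unshelve. all: by end_near. Qed.

(** The supremum of candidates covering more and more, with [kap] and [t] equal to [1 / (m + 1)] on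
    the window of radius [m]. A zero of the supremum is a zero of every candidate, so in a fixed
    window the zeros in [E] with [rho > 0] have measure at most [1 / (m + 1)] for all large [m]. *)
Lemma good_scale E F rho eps :
  measurable E -> distribution_of E F ->
  (forall x, 0 <= rho x) -> lipwrt F (8^-1) rho ->
  0 < eps -> eps <= 1 -> mu (E `&` [set x | rho x = 0%R]) = 0%E ->
  exists rho' : R -> R,
  [/\ forall x, 0 <= rho' x <= rho x,
      lipwrt F (8^-1) rho',
      forall x, deficit F x (rho' x) <= eps * rho' x,
      forall z, rho' z = 0 -> flat_at rho' z &
      mu (E `&` [set x | rho' x = 0%R]) = 0%E].
Proof.
move=> mE EF rho0 rhoL eps0 eps1 Erho.
have HF := distribution_nonexp mE EF.
have H (m : nat) : exists g, admissible F rho eps m.+1%:R^-1 g /\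
    (mu (E `&` [set x | (0 < rho x)%R] `&` `](- m%:R)%R, m%:R%R] `&` [set x | g x = 0%R])
      <= m.+1%:R^-1%:E)%E.
  have [|||g gA Hg] := @admissible_cover E F rho eps m.+1%:R^-1 m%:R m.+1%:R^-1
    mE EF rho0 rhoL eps0 eps1 => //.
    by rewrite invf_le1// ler1n.
  by exists g.
have {H} [g gH] := choice H.
have gA m := (gH m).1.
have := admissible_supf HF (ltW eps0) rho0 gA; set rho' := supf _ _.
move=> [r1 r2 r3 r4 r5]; exists rho'; split => //.
have cr : continuous rho' by apply: lipwrt_continuous HF _ r2; rewrite invr_ge0.
have crho : continuous rho by apply: lipwrt_continuous HF _ rhoL; rewrite invr_ge0.
have mz h : continuous h -> measurable [set x : R | h x = 0 :> R].
  by move=> hA; apply: closed_measurable; exact: closed_zero.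
have mpos : measurable [set x | 0 < rho x] by apply: open_measurable; exact: open_pos.
pose Z := (E `&` [set x | rho x = 0]) `|`
  \bigcup_(N in [set: nat])
     (E `&` [set x | 0 < rho x] `&` `](- N%:R)%R, N%:R%R] `&` [set x | rho' x = 0]).
suff negZ : mu.-negligible Z.
  apply: measure_negligible; first by apply: measurableI => //; exact: mz.
  apply: negligibleS negZ.
  move=> x [Ex r'x]; have [rx|rx] := eqVneq (rho x) 0; first by left.
  have [N Nx] : exists N : nat, `|x| < N%:R.
    by near \oo => N; exists N; near: N; exact: nbhs_infty_gtr.
  right; exists N => //; split => //; split; last first.
    by move: Nx; rewrite /= in_itv/= ltr_norml => /andP[-> /ltW].
  by split => //=; rewrite lt_neqAle eq_sym rx rho0.
apply: negligibleU.
  by apply/negligibleP => //; apply: measurableI => //; exact: mz.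
apply: negligible_bigcup => N.
have mN : measurable (E `&` [set x | 0 < rho x] `&` `](- N%:R)%R, N%:R%R] `&` [set x | rho' x = 0]).
  by apply: measurableI; [apply: measurableI => //; exact: measurableI|exact: mz].
apply/negligibleP => //; apply/eqP; rewrite -measure_le0.
apply/lee_addgt0Pr => e e0; rewrite add0e.
near \oo => m.
have Nm : (N <= m)%N by near: m; exact: nbhs_infty_ge.
apply: (@le_trans _ _ (m.+1%:R^-1%:E)); last first.
  by rewrite lee_fin; apply: ltW; near: m; exact: near_infty_natSinv_lt (PosNum e0).
apply: le_trans (gH m).2; apply: le_measure_sub => //.
  apply: measurableI; last by apply: mz; exact: admissible_continuous (gA m).
  by apply: measurableI => //; exact: measurableI.
move=> x [[Ex xN] r'x]; split; last exact: r5.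
split => //; move: xN; rewrite /= !in_itv/= => /andP[xN1 xN2].
have : N%:R <= m%:R :> R by rewrite ler_nat.
lra.
Unshelve. all: by end_near. Qed.

End key.

(** * Flattening *)

Section flatten.
Context {R : realType}.
Local Notation mu := (@lebesgue_measure R).
Implicit Types (E A B : set R) (x y z p r c d t s eps kap eta L lam : R).
Implicit Types (F rho f psi : R -> R).

Lemma distribution_dist E F x y : measurable E -> distribution_of E F ->
  mu (E `&` `](Num.min x y), (Num.max x y)]) = `|F x - F y|%:E.
Proof.
move=> mE EF; have HF := distribution_nonexp mE EF.
rewrite EF; last by rewrite ge_min le_max lexx.
congr EFin; rewrite /Num.min /Num.max; case: ltP => xy.
  by rewrite distrC ger0_norm// subr_ge0 nonexp_le// ltW.
by rewrite ger0_norm// subr_ge0 nonexp_le.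
Qed.

(** [V] is the part of [E] to be discarded around the new zeros. Its piece [W k] lies where
    [rho > th k] and meets [E] in measure at most [eta * th k ^ 2]. Where [rho <= s] only pieces
    with [th k < s] occur; each contributes at most [eta * s * th k], and the [th k] sum to 1. *)
Lemma thin_neighbourhood E F rho rho' eta :
  measurable E -> distribution_of E F ->
  (forall x, 0 <= rho x) -> lipwrt F (8^-1) rho ->
  (forall x, 0 <= rho' x) -> lipwrt F (8^-1) rho' ->
  mu (E `&` [set x | rho' x = 0%R]) = 0%E -> 0 < eta ->
  exists V : set R,
  [/\ open V, forall z, rho' z = 0 -> 0 < rho z -> V z &
      forall B s, measurable B -> 0 <= s -> (forall x, B x -> rho x <= s) ->
        (mu (E `&` B `&` V) <= (eta * s)%:E)%E].
Proof.
move=> mE EF rho0 rhoL rho'0 rho'L Erho' eta0.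
have HF := distribution_nonexp mE EF.
have cr : continuous rho by apply: lipwrt_continuous HF _ rhoL; rewrite invr_ge0.
have cr' : continuous rho' by apply: lipwrt_continuous HF _ rho'L; rewrite invr_ge0.
pose th (k : nat) : R := ((2 ^ k.+1)%:R)^-1.
have th0 k : 0 < th k by rewrite /th invr_gt0 ltr0n expn_gt0.
have H (k : nat) : exists d, 0 < d /\
    (mu ((E `&` `](- k%:R)%R, k%:R%R]) `&` [set x | (rho' x < d)%R])
      <= (eta * (th k * th k))%:E)%E.
  have mEk : measurable (E `&` `](- k%:R)%R, k%:R%R]) by exact: measurableI.
  have Efin : (mu (E `&` `](- k%:R)%R, k%:R%R]) < +oo)%E.
    apply: (@le_lt_trans _ _ (mu `](- k%:R)%R, k%:R%R]%classic)).
      by apply: le_measure_sub => // x [].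
    by rewrite lebesgue_measure_itv/=; case: ifP => _; rewrite ?ltry.
  have mz : measurable [set x | rho' x = 0].
    by apply: closed_measurable; exact: closed_zero.
  have E0 : mu ((E `&` `](- k%:R)%R, k%:R%R]) `&` [set x | rho' x = 0%R]) = 0%E.
    apply/eqP; rewrite -measure_le0 -Erho'; apply: le_measure_sub.
    + exact: measurableI.
    + exact: measurableI.
    + by move=> x [[Ex _] rx].
  have t0 : 0 < eta * (th k * th k) by rewrite !mulr_gt0.
  have [d d0 Hd] := small_sublevel mEk Efin cr' rho'0 E0 t0.
  by exists d.
have {H} [d dH] := choice H.
(* The bounded window gives finite measure, so that a sublevel set of [rho'] of small measure
   exists. A given new zero enters [W k] once [k] is large. *)
pose W k := [set x | th k < rho x] `&` `](- k%:R)%R, k%:R%R[ `&` [set x | rho' x < d k].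
have oW k : open (W k).
  apply: openI; last by apply: open_comp (@open_lt _ (d k)) => x _; exact: cr'.
  apply: openI; first by apply: open_comp (@open_gt _ (th k)) => x _; exact: cr.
  exact: itv_open.
exists (\bigcup_k W k); split.
- by apply: bigcup_open => k _; exact: oW.
- move=> z z0 rz.
  near \oo => k; exists k => //; split; last by rewrite /= z0; exact: (dH k).1.
  split => /=; last first.
    rewrite in_itv/= -ltr_norml.
    by near: k; exact: nbhs_infty_gtr.
  apply: (@lt_trans _ _ k.+1%:R^-1); last first.
    by near: k; exact: near_infty_natSinv_lt (PosNum rz).
  rewrite /th ltf_pV2 ?posrE ?ltr0n ?expn_gt0// ltr_nat.
  exact: ltn_expl.
- move=> B s mB s0 Bs.
  have mW k : measurable (E `&` B `&` W k).
    by apply: measurableI; [exact: measurableI|exact: open_measurable].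
  have sub : E `&` B `&` \bigcup_k W k `<=` \bigcup_k (E `&` B `&` W k).
    by rewrite setI_bigcupr.
  have mU : measurable (E `&` B `&` \bigcup_k W k).
    by rewrite setI_bigcupr; exact: bigcupT_measurable.
  have := @measure_sigma_subadditive _ _ _ mu _ _ mW mU sub.
  move=> /le_trans; apply.
  have es0 : 0 <= eta * s by rewrite mulr_ge0// ltW.
  apply: le_trans (@epsilon_trick0 R (eta * s) xpredT es0).
  apply: lee_nneseries => [k _ _|k _]; first exact: measure_ge0.
  have [sk|ks] := leP s (th k).
    rewrite (_ : E `&` B `&` W k = set0) ?measure0 ?lee_fin ?divr_ge0//.
    apply/seteqP; split => // x [[_ Bx] [[/= kx _] _]].
    by have := Bs x Bx; lra.
  apply: (@le_trans _ _ ((eta * (th k * th k))%:E)).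
    apply: le_trans (dH k).2; apply: le_measure_sub => //.
      apply: measurableI; first exact: measurableI.
      by apply: open_measurable; apply: open_comp (@open_lt _ (d k)) => x _; exact: cr'.
    move=> x [[Ex Bx] [[_ /= xk] rx]]; split => //; split => //=.
    by move: xk; rewrite !in_itv/=; lra.
  rewrite lee_fin -/(th k) mulrA ler_wpM2r ?(ltW (th0 k))//.
  by rewrite ler_pM2l// ltW.
Unshelve. all: by end_near. Qed.

(** Let [G] be the distribution function of [E] without [V]; it is constant near each new zero.
    [psi] is the smallest majorant of [f] that is [kap]-Lipschitz for [G]. Passing from [F] to [G]
    loses little at distances beyond the scale of [rho], which the gap between [L] and [kap] and the
    allowance [rho / 4] absorb. *)
Lemma exists_flattening E F rho rho' f L kap :
  measurable E -> distribution_of E F ->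
  (forall x, 0 <= rho x) -> lipwrt F (8^-1) rho ->
  (forall x, 0 <= rho' x) -> lipwrt F (8^-1) rho' ->
  mu (E `&` [set x | rho' x = 0%R]) = 0%E ->
  0 <= L -> L < kap -> kap <= 1 -> lipwrt F L f ->
  exists psi : R -> R,
  [/\ lipwrt F kap psi, forall x, f x <= psi x <= f x + rho x / 4 &
      forall z, rho' z = 0 -> 0 < rho z ->
        exists2 d, 0 < d & forall y, `|y - z| < d -> psi y = psi z].
Proof.
move=> mE EF rho0 rhoL rho'0 rho'L Erho' L0 Lk k1 fL.
have HF := distribution_nonexp mE EF.
(* The bound 1/8 keeps the loss proportional to [rho x] below [rho x / 4]; the bound [kap - L]
   absorbs the loss proportional to [|F p - F x|]. *)
pose eta := Num.min (8^-1) (kap - L).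
have eta0 : 0 < eta by rewrite lt_min invr_gt0 ltr0n/=; lra.
have eta1 : eta <= 8^-1 by rewrite ge_min lexx.
have eta2 : eta <= kap - L by rewrite ge_min lexx orbT.
have [V [oV VZ HV]] := thin_neighbourhood mE EF rho0 rhoL rho'0 rho'L Erho' eta0.
have mV : measurable V by exact: open_measurable.
have mEV : measurable (E `\` V) by exact: measurableD.
have [G EG] := distribution_exists mEV.
have GF x y : `|G x - G y| <= `|F x - F y|.
  rewrite -lee_fin -!(@distribution_dist _ _ x y mE EF) -(@distribution_dist _ _ x y mEV EG).
  apply: le_measure_sub; [exact: measurableI|exact: measurableI|].
  by move=> t [[Et _] xt]; split.
(* Between [p] and [x] the function [rho] is at most [rho x + |F p - F x| / 8], which is the [s]
   used for [V]. *)
have FG p x : `|F p - F x| <= `|G p - G x| + eta * (rho x + 8^-1 * `|F p - F x|).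
  rewrite -lee_fin EFinD -(@distribution_dist _ _ p x mEV EG) -(@distribution_dist _ _ p x mE EF).
  pose B : set R := `](Num.min p x), (Num.max p x)]%classic.
  have mB : measurable B by exact: measurable_itv.
  apply: (@le_trans _ _ (mu (((E `\` V) `&` B) `|` (E `&` B `&` V)))).
    apply: le_measure_sub; first exact: measurableI.
      by apply: measurableU; apply: measurableI => //; exact: measurableI.
    move=> t [Et Bt]; have [Vt|Vt] := pselect (V t); first by right; split.
    by left; split.
  apply: (le_trans (le_lebesgue_measureU _ _)); first exact: measurableI.
    by apply: measurableI => //; exact: measurableI.
  rewrite leeD2l// HV//; first by rewrite addr_ge0// mulr_ge0// invr_ge0.
  move=> t; rewrite /B/= in_itv/= => /andP[t1 t2].
  have := rhoL t x; rewrite ler_norml => /andP[_].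
  suff : `|F t - F x| <= `|F p - F x| by lra.
  move: t1 t2; rewrite /Num.min /Num.max; case: (ltP p x) => px t1 t2.
    have := nonexp_le HF (ltW t1); have := nonexp_le HF t2 => h1 h2.
    by rewrite distrC (distrC (F p)) !ger0_norm//; lra.
  have := nonexp_le HF (ltW t1); have := nonexp_le HF t2 => h1 h2.
  by rewrite !ger0_norm//; lra.
pose g p x := f p - kap * `|G p - G x|.
have gub x p : setT p -> g p x <= f x + rho x / 4.
  move=> _; rewrite /g.
  have := fL p x; rewrite ler_norml => /andP[_ h1].
  have h2 := FG p x.
  set t := `|F p - F x| in h1 h2 *; set u := `|G p - G x| in h2 *.
  have t0 : 0 <= t by exact: normr_ge0.
  have h3 : kap * t <= kap * (u + eta * (rho x + 8^-1 * t)) by rewrite ler_wpM2l//; lra.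
  have h4 : kap * (eta * (rho x + 8^-1 * t)) <= eta * (rho x + 8^-1 * t).
    by rewrite ler_piMl// !mulr_ge0 ?(ltW eta0)// addr_ge0// mulr_ge0// invr_ge0.
  have h5 : eta * rho x <= 8^-1 * rho x by rewrite ler_wpM2r.
  have h6 : eta * t <= (kap - L) * t by rewrite ler_wpM2r.
  have h7 : 0 <= (kap - L) * t by rewrite mulr_ge0//; lra.
  have h8 := rho0 x; lra.
have D0 : [set: R] !=set0 by exists 0.
have psiG : lipwrt G kap (supf setT g).
  apply: lipwrt_supf => // [p _|x]; last by exists (f x + rho x / 4); exact: gub.
  apply: lipwrt_le => x y; rewrite /g.
  have : `|G p - G y| <= `|G p - G x| + `|G x - G y|.
    by rewrite (le_trans _ (ler_normD _ _))// addrA subrK.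
  move=> h; have : kap * `|G p - G y| <= kap * (`|G p - G x| + `|G x - G y|).
    by rewrite ler_wpM2l//; lra.
  lra.
exists (supf setT g); split.
- by move=> x y; apply: (le_trans (psiG x y)); rewrite ler_wpM2l//; lra.
- move=> x; apply/andP; split.
    have := supf_ge (gub x) (I : setT x); apply: le_trans.
    by rewrite /g subrr normr0 mulr0 subr0.
  by apply: supf_le => // p; exact: gub.
- move=> z rz0 rz.
  have : nbhs z V by apply: open_nbhs_nbhs; split => //; exact: VZ.
  move=> [d/= d0 Hd]; exists d => // y yd.
  have Gyz : `|G y - G z| = 0.
    apply: EFin_inj; rewrite -(@distribution_dist _ _ y z mEV EG).
    rewrite (_ : _ `&` _ = set0) ?measure0//.
    apply/seteqP; split => // t [[_ nVt]]/=; rewrite in_itv/= => /andP[t1 t2].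
    apply: nVt; apply: Hd => /=; apply: le_lt_trans yd.
    move: t1 t2; rewrite /Num.min /Num.max; case: (ltP y z) => yz t1 t2.
      by rewrite [leRHS]distrC !ger0_norm//; lra.
    by rewrite distrC !ger0_norm//; lra.
  have := psiG y z; rewrite Gyz mulr0 normr_le0 subr_eq0 => /eqP //.
Qed.

End flatten.

(** * Extremal Lipschitz extension *)

Section nodes.
Context {R : realType}.
Implicit Types (x y q s : R) (r : R -> R) (k : int) (m n : nat).

Definition dyadic k m : R := k%:~R / 2 ^+ m.

(** Over the common denominator [2 ^ m] the numerators are distinct integers. *)
Lemma dyadic_sep k k' m m' : (m' <= m)%N -> dyadic k m != dyadic k' m' ->
  (2 ^+ m)^-1 <= `|dyadic k m - dyadic k' m'|.
Proof.
move=> mm; have p0 n : 0 < 2 ^+ n :> R by rewrite exprn_gt0.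
have -> : dyadic k' m' = dyadic (k' * 2 ^+ (m - m')) m.
  rewrite /dyadic rmorphM rmorphXn/= -{2}(subnK mm) exprD -[2%:~R]/(2 : R).
  by field; rewrite !gt_eqF.
move=> kk; rewrite /dyadic -mulrBl -rmorphB normrM normfV (gtr0_norm (p0 m)).
rewrite ler_peMl ?invr_ge0 ?(ltW (p0 m))// -intr_norm -[1]/(1%:~R) ler_int.
rewrite -gtz0_ge1 normr_gt0 subr_eq0.
by apply: contraNN kk => /eqP ->.
Qed.

(** A dyadic point of level [m] is kept where [r] is at most the mesh, so that the gaps between
    nodes are comparable with [r]. Zeros of [r] are nodes, where the extension will keep its
    prescribed value. *)
Definition nodes r := [set q | r q = 0 \/ exists k m, q = dyadic k m /\ r q <= (2 ^+ m)^-1].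

(** Let [m] be the least level with mesh at most [4 * r x]. By minimality the mesh is at least
    [2 * r x] (for [m = 0] by [r <= 1/4]), so the dyadic point just below [x] is a node: [r] grows
    by at most an eighth of the mesh on the way to it. *)
Lemma nodes_cover r x : (forall x, 0 <= r x <= 4^-1) ->
  (forall x y, `|r x - r y| <= 8^-1 * `|x - y|) ->
  exists2 q, nodes r q & `|q - x| <= 4 * r x.
Proof.
move=> r01 rL; have [rx|rx] := eqVneq (r x) 0.
  by exists x; [left|rewrite subrr normr0 rx mulr0].
have {}rx : 0 < r x by rewrite lt_neqAle eq_sym rx; have /andP[] := r01 x.
have p0 n : 0 < 2 ^+ n :> R by rewrite exprn_gt0.
have ex : exists n, (2 ^+ n)^-1 <= 4 * r x.
  have r40 : 0 < 4 * r x by rewrite mulr_gt0.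
  near \oo => n; exists n; apply: (@le_trans _ _ n.+1%:R^-1); last first.
    by apply: ltW; near: n; exact: near_infty_natSinv_lt (PosNum r40).
  by rewrite lef_pV2 ?posrE// -natrX ler_nat ltn_expl.
case: (ex_minnP ex) => m mr mmin.
have m2 : 2 * r x <= (2 ^+ m)^-1.
  case: m mr mmin => [|m] mr mmin.
    by rewrite expr0 invr1; have := r01 x; lra.
  rewrite leNgt; apply/negP => h.
  have : (2 ^+ m)^-1 <= 4 * r x.
    have -> : (2 ^+ m)^-1 = 2 * (2 ^+ m.+1)^-1 :> R.
      by rewrite exprS; field; rewrite gt_eqF.
    lra.
  by move/mmin; rewrite ltnn.
pose q := dyadic (Num.floor (x * 2 ^+ m)) m.
have qx : q <= x.
  by rewrite /q /dyadic ler_pdivrMr// floor_le.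
have xq : x < q + (2 ^+ m)^-1.
  by rewrite /q /dyadic -[X in _ + X]mul1r -mulrDl ltr_pdivlMr// -intrD1 floorD1_gt.
have dqx : `|q - x| <= 4 * r x by rewrite distrC ger0_norm; lra.
exists q => //; right; exists (Num.floor (x * 2 ^+ m)), m; split => //.
have := rL q x; rewrite ler_norml => /andP[_]; lra.
Unshelve. all: by end_near. Qed.

(** Two dyadic nodes are at least the finer mesh apart, which bounds [r] at the node of that level;
    the slope 1/8 of [r] transfers this to [q]. *)
Lemma nodes_sep r q q' : (forall x, 0 <= r x) ->
  (forall x y, `|r x - r y| <= 8^-1 * `|x - y|) ->
  nodes r q -> nodes r q' -> q != q' -> 0 < r q -> r q / 2 <= `|q - q'|.
Proof.
move=> r0 rL Qq Qq' qq' rq.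
have /andP[_ h] : - (8^-1 * `|q - q'|) <= r q - r q' <= 8^-1 * `|q - q'|.
  by rewrite -ler_norml.
case: Qq => [rq0|[k [m [qE rqm]]]]; first by move: rq; rewrite rq0 ltxx.
case: Qq' => [rq'0|[k' [m' [q'E rqm']]]]; first by lra.
have [mm|/ltnW mm] := leqP m' m.
  by have := @dyadic_sep k k' m m' mm; rewrite -qE -q'E => /(_ qq'); lra.
have := @dyadic_sep k' k m' m mm; rewrite -qE -q'E eq_sym distrC => /(_ qq'); lra.
Qed.

End nodes.

(** * Slopes of the McShane extension from the nodes *)

Section mcshane.
Context {R : realType}.
Implicit Types (x y z p q c d e s w rh eps kap lam : R).
Implicit Types (F rho psi : R -> R) (Q : set R).

Definition cone F lam psi q x := psi q - lam * `|F q - F x|.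

(** For [psi] Lipschitz with a constant at most [lam], this is the smallest [lam]-Lipschitz
    extension of the restriction of [psi] to [Q]. *)
Definition mcshane F lam psi Q : R -> R := supf Q (cone F lam psi).

Lemma mcshane_ub F kap lam psi Q x : kap <= lam -> lipwrt F kap psi ->
  forall q, Q q -> cone F lam psi q x <= psi x.
Proof.
move=> kl psiL q _; rewrite /cone; have := psiL q x; rewrite ler_norml => /andP[_ h].
have : kap * `|F q - F x| <= lam * `|F q - F x| by rewrite ler_wpM2r.
lra.
Qed.

Lemma mcshane_ge F kap lam psi Q x q : kap <= lam -> lipwrt F kap psi ->
  Q q -> psi q - lam * `|F q - F x| <= mcshane F lam psi Q x.
Proof.
by move=> kl psiL Qq; have := supf_ge (mcshane_ub x kl psiL) Qq.
Qed.

Lemma mcshane_le F kap lam psi Q x : kap <= lam -> lipwrt F kap psi ->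
  Q !=set0 -> mcshane F lam psi Q x <= psi x.
Proof. by move=> kl psiL Q0; apply: supf_le => //; exact: mcshane_ub kl psiL. Qed.

Lemma mcshane_node F kap lam psi Q q : kap <= lam -> lipwrt F kap psi ->
  Q q -> mcshane F lam psi Q q = psi q.
Proof.
move=> kl psiL Qq; apply/eqP; rewrite eq_le (mcshane_le _ kl psiL)/=; last by exists q.
by have := mcshane_ge q kl psiL Qq; rewrite subrr normr0 mulr0 subr0.
Qed.

Lemma mcshane_lip F kap lam psi Q : 0 <= lam -> kap <= lam -> lipwrt F kap psi ->
  Q !=set0 -> lipwrt F lam (mcshane F lam psi Q).
Proof.
move=> lam0 kl psiL Q0; apply: lipwrt_supf => // [q _|x]; last first.
  by exists (psi x); exact: mcshane_ub kl psiL.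
apply: lipwrt_le => x y; rewrite /cone; have h := ler_distD (F x) (F q) (F y).
have : lam * `|F q - F y| <= lam * (`|F q - F x| + `|F x - F y|) by rewrite ler_wpM2l.
lra.
Qed.

(** Since [psi] has the smaller constant [kap], the cone of another node [q'] starts at most
    [kap * |F q - F q'|] higher and has dropped further by the time it reaches [w]. *)
Lemma mcshane_near F kap lam psi Q q w : kap <= lam -> lipwrt F kap psi ->
  Q q -> 0 <= lam ->
  (forall q', Q q' -> q' != q ->
     2 * lam * `|F q - F w| <= (lam - kap) * `|F q - F q'|) ->
  mcshane F lam psi Q w = psi q - lam * `|F q - F w|.
Proof.
move=> kl psiL Qq lam0 H; apply/eqP; rewrite eq_le (mcshane_ge w kl psiL Qq) andbT.
apply: supf_le => [|q' Qq']; first by exists q.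
rewrite /cone; have [->//|qq'] := eqVneq q' q.
have h1 := H q' Qq' qq'.
have := psiL q' q; rewrite ler_norml (distrC (F q')) => /andP[_ h2].
have h3 := ler_distD (F w) (F q) (F q'); rewrite (distrC (F w)) in h3.
have : lam * `|F q - F q'| <= lam * (`|F q - F w| + `|F q' - F w|) by rewrite ler_wpM2l.
lra.
Qed.

(** [q] almost realizes the supremum at [x], so slope [lam] is almost attained between them. Its
    cone is nearly as high at [x] as that of [q0], which bounds how far away [q] can be. *)
Lemma mcshane_far F kap lam psi Q x q0 e : kap <= lam -> lipwrt F kap psi ->
  0 <= kap -> Q q0 -> 0 < e ->
  exists q, [/\ Q q,
    (lam - kap) * `|F q - F x| <= (lam + kap) * `|F q0 - F x| + e &
    lam * `|F q - F x| - e <= mcshane F lam psi Q q - mcshane F lam psi Q x].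
Proof.
move=> kl psiL kap0 Qq0 e0.
have Q0 : Q !=set0 by exists q0.
have [q Qq] := supf_adherent Q0 (mcshane_ub x kl psiL) e0.
rewrite -/(mcshane _ _ _ _ _) /cone => fq; exists q; split => //.
  have f0 := mcshane_ge x kl psiL Qq0.
  have := psiL q q0; rewrite ler_norml => /andP[_ h1].
  have h2 := ler_distD (F x) (F q) (F q0); rewrite (distrC (F x)) in h2.
  have : kap * `|F q - F q0| <= kap * (`|F q - F x| + `|F q0 - F x|) by rewrite ler_wpM2l.
  lra.
by rewrite (mcshane_node kl psiL Qq); lra.
Qed.

(** The segment of length [s] from [u] towards [v] stays in the window about [x], where [F] loses at
    most [e] against length. *)
Lemma nonexp_sep F x rh e u v s : nonexp F -> deficit F x rh <= e ->
  0 <= s -> `|u - x| + s <= rh -> s <= `|u - v| -> s - e <= `|F u - F v|.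
Proof.
move=> HF dx s0 us uv.
have /andP[u1 u2] : - (rh - s) <= u - x <= rh - s by rewrite -ler_norml; lra.
have [lt|lt] := ltP u v.
  have s1 : u + s <= v by move: uv; rewrite distrC gtr0_norm ?subr_gt0//; lra.
  have h1 := nonexp_le HF s1.
  have := @interval_deficit _ F x rh u (u + s) HF ltac:(lra) ltac:(lra) ltac:(lra).
  by rewrite distrC => h2; apply: le_trans (ler_norm _); lra.
have s1 : v <= u - s by move: uv; rewrite ger0_norm ?subr_ge0//; lra.
have h1 := nonexp_le HF s1.
have := @interval_deficit _ F x rh (u - s) u HF ltac:(lra) ltac:(lra) ltac:(lra).
by move=> h2; apply: le_trans (ler_norm _); lra.
Qed.

(** Choose [y] on the side of [x] away from [q]: then [F]-distances from [q] add up, and [f] drops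
    by [lam * |F x - F y|] between [x] and [y]. *)
Lemma cone_slope F (f : R -> R) x rh e q c lam k : nonexp F -> deficit F x rh <= e ->
  0 <= lam -> lam <= 1 -> 0 < c -> 2 * c <= rh -> `|q - x| <= c -> 0 <= e ->
  (forall w, `|w - q| <= 3 * c -> f w = k - lam * `|F q - F w|) ->
  exists2 y, `|x - y| = 2 * c & lam * (2 * c) - e <= `|f x - f y|.
Proof.
move=> HF dx lam0 lam1 c0 crh qx e0 fE.
have le : lam * e <= e by rewrite ler_piMl.
have fx : f x = k - lam * `|F q - F x| by apply: fE; rewrite distrC; lra.
have main y : `|x - y| = 2 * c -> `|F x - F y| = `|(`|F q - F y| - `|F q - F x|)| ->
    `|y - q| <= 3 * c -> lam * (2 * c) - e <= `|f x - f y|.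
  move=> xy Fq yq; rewrite fx fE//.
  rewrite (_ : k - _ - (k - _) = lam * (`|F q - F y| - `|F q - F x|)); last by lra.
  rewrite normrM (ger0_norm lam0) -Fq.
  have s0 : 0 <= 2 * c by lra.
  have := nonexp_sep HF dx s0 _ (_ : 2 * c <= `|x - y|).
  rewrite subrr normr0 add0r xy => /(_ crh (lexx _)) h.
  have : lam * (2 * c - e) <= lam * `|F x - F y| by rewrite ler_wpM2l.
  lra.
move: qx; rewrite ler_distl => /andP[q1 q2].
have [qlex|xltq] := leP q x.
  have xy : x <= x + 2 * c by lra.
  exists (x + 2 * c); first by rewrite distrC ger0_norm; lra.
  apply: main; [by rewrite distrC ger0_norm; lra| |by rewrite ger0_norm; lra].
  have := nonexp_le HF qlex; have := nonexp_le HF xy => h1 h2.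
  rewrite (distrC (F x)) (distrC (F q)) (distrC (F q)).
  rewrite (ger0_norm (_ : 0 <= F (x + 2 * c) - F x)); last by lra.
  rewrite (ger0_norm (_ : 0 <= F (x + 2 * c) - F q)); last by lra.
  rewrite (ger0_norm (_ : 0 <= F x - F q)); last by lra.
  by rewrite ger0_norm; lra.
have yx : x - 2 * c <= x by lra.
exists (x - 2 * c); first by rewrite ger0_norm; lra.
apply: main; [by rewrite ger0_norm; lra| |by rewrite distrC ger0_norm; lra].
have := nonexp_le HF (ltW xltq); have := nonexp_le HF yx => h1 h2.
rewrite (ger0_norm (_ : 0 <= F x - F (x - 2 * c))); last by lra.
rewrite (ger0_norm (_ : 0 <= F q - F (x - 2 * c))); last by lra.
rewrite (ger0_norm (_ : 0 <= F q - F x)); last by lra.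
by rewrite ger0_norm; lra.
Qed.

(* The slope [lam] is attained from [x] either towards a point past a very close
   node, or towards the node that (almost) realizes the supremum at [x]. *)
Lemma mcshane_slope F (r : R -> R) psi kap lam eps x rh : nonexp F ->
  0 <= kap -> kap < lam -> lam <= 1 -> 0 < eps -> eps <= 1 -> lipwrt F kap psi ->
  (forall x, 0 <= r x <= 4^-1) ->
  (forall x y, `|r x - r y| <= 8^-1 * `|x - y|) ->
  0 < r x -> 64 * r x = (lam - kap) * rh ->
  deficit F x rh <= eps * (lam - kap) / 128 * r x ->
  exists y, [/\ (lam - kap) / 32 * r x <= `|x - y|, `|x - y| <= rh &
    (lam - eps) * `|x - y| <=
      `|mcshane F lam psi (nodes r) x - mcshane F lam psi (nodes r) y|].
Proof.
move=> HF kap0 kl lam1 eps0 eps1 psiL r14 rL rx0 rE.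
have lam0 : 0 <= lam by lra.
have lek := ltW kl.
have D0 : 0 < lam - kap by lra.
have D1 : lam - kap <= 1 by lra.
have DE : lam = kap + (lam - kap) by lra.
move: (lam - kap) D0 D1 rE DE => D D0 D1 rE DE.
set e := eps * D / 128 * r x => dx.
have e0 : 0 < e by rewrite /e !mulr_gt0// invr_gt0.
have eDr : 128 * e <= D * r x.
  by rewrite /e; have : eps * (D * r x) <= 1 * (D * r x); [rewrite ler_wpM2r// mulr_ge0// ltW|lra].
have Dr1 : D * r x <= r x by rewrite ler_piMl// ltW.
have Dr0 : 0 < D * r x by rewrite mulr_gt0.
(* The density error [e] is a quarter of [eps] times the least distance allowed for [y]. *)
have eE : eps * (D / 32 * r x) = 4 * e by rewrite /e; lra.
clearbody e.
have rrh : 64 * r x <= rh.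
  have rh0 : 0 < rh by rewrite -(pmulr_rgt0 _ D0); lra.
  by rewrite rE ler_piMl// ltW.
have r0 y : 0 <= r y by have /andP[] := r14 y.
(* A node this close to [x] is isolated at the scale of [r x], so around it the extension is a
   single cone. *)
have [[q Qq qx]|noq] := pselect (exists2 q, nodes r q & `|q - x| <= D / 32 * r x).
  have fE w : `|w - q| <= 3 * (D / 32 * r x) ->
      mcshane F lam psi (nodes r) w = psi q - lam * `|F q - F w|.
    move=> wq; apply: (mcshane_near lek psiL Qq lam0) => q' Qq' qq'.
    have rq : 3 / 4 * r x <= r q.
      have := rL q x; rewrite ler_norml => /andP[h _].
      by move: h qx Dr1 Dr0; clear; lra.
    have sep : r q / 2 <= `|q - q'|.
      apply: nodes_sep Qq Qq' _ _ => //; first by rewrite eq_sym.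
      by move: rq rx0; clear; lra.
    have s0 : 0 <= 3 / 8 * r x by move: rx0; clear; lra.
    have Fqq' : 3 / 8 * r x - e <= `|F q - F q'|.
      apply: (nonexp_sep HF dx s0); first by move: qx rrh Dr1 rx0; clear; lra.
      by move: sep rq; clear; lra.
    have h4 : `|F q - F w| <= 3 * (D / 32 * r x).
      by apply: le_trans wq; rewrite distrC; exact: nonexp_dist.
    have h5 : D * (r x / 4) <= D * `|F q - F q'|.
      by rewrite ler_pM2l//; move: Fqq' eDr Dr1 rx0; clear; lra.
    have h6 : lam * `|F q - F w| <= 1 * (3 * (D / 32 * r x)).
      exact: ler_pM.
    have -> : lam - kap = D by move: DE; clear; lra.
    by move: h5 h6 Dr0; clear; lra.
  have c0 : 0 < D / 32 * r x by move: Dr0; clear; lra.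
  have crh : 2 * (D / 32 * r x) <= rh by move: Dr1 rrh rx0; clear; lra.
  have [y xy fy] := cone_slope HF dx lam0 lam1 c0 crh qx (ltW e0) fE.
  exists y; rewrite xy; split => //; first by move: c0; clear; lra.
  by apply: le_trans fy; move: eE e0; clear; lra.
(* Without such a node, the cone of [q0] confines the almost optimal [q] to [F]-distance
   [9 * r x / D]. As density holds up to [rh = 64 * r x / D], its distance from [x] is at most
   [rh]. *)
have [q0 Qq0 q0x] := nodes_cover x r14 rL.
have [q [Qq qfar fq]] := mcshane_far x lek psiL kap0 Qq0 e0.
have qx : D / 32 * r x < `|x - q|.
  by rewrite ltNge distrC; apply/negP => h; apply: noq; exists q.
have h4 : (lam + kap) * `|F q0 - F x| <= 2 * (4 * r x).
  apply: ler_pM => //; [by lra|by lra|].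
  by apply: le_trans q0x; exact: nonexp_dist.
have h5 : D * `|F q - F x| <= 9 * r x.
  move: qfar; have -> : lam - kap = D by move: DE; clear; lra.
  by move: h4 eDr Dr1 rx0; clear; lra.
have sep s : 0 <= s -> s <= rh -> s <= `|x - q| -> s - e <= `|F q - F x|.
  move=> s0 srh sx; rewrite distrC; apply: (nonexp_sep HF dx s0) sx.
  by rewrite subrr normr0 add0r.
have qrho : `|x - q| <= rh.
  rewrite leNgt; apply/negP => h.
  have rh0 : 0 <= rh by move: rrh rx0; clear; lra.
  have h6 := sep rh rh0 (lexx _) (ltW h).
  have : D * (rh - e) <= D * `|F q - F x| by rewrite ler_pM2l.
  have : D * e <= e by rewrite ler_piMl// ltW.
  by move: h5 rE eDr Dr1 rx0; clear; lra.
exists q; split => //; first exact: ltW.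
have h6 := sep _ (normr_ge0 _) qrho (lexx _).
have h7 : lam * (`|x - q| - e) <= lam * `|F q - F x| by rewrite ler_wpM2l.
have h8 : lam * e <= e by rewrite ler_piMl// ltW.
rewrite [leRHS]distrC; apply: le_trans (ler_norm _).
have h10 : eps * (D / 32 * r x) <= eps * `|x - q| by rewrite ler_pM2l// ltW.
by move: h10 h7 h8 fq eE e0; clear; lra.
Qed.

Lemma zigzag F rho psi kap lam eps : nonexp F -> 0 <= kap -> kap < lam ->
  lam <= 1 -> 0 < eps -> eps <= 1 -> lipwrt F kap psi ->
  (forall x, 0 <= rho x <= 1) -> lipwrt F (8^-1) rho ->
  (forall x, deficit F x (rho x) <= eps * (lam - kap) ^+ 2 / 8192 * rho x) ->
  exists f : R -> R,
  [/\ lipwrt F lam f, forall x, psi x - rho x / 8 <= f x <= psi x &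
      forall x, 0 < rho x -> exists y,
        [/\ (lam - kap) ^+ 2 / 2048 * rho x <= `|x - y|, `|x - y| <= rho x &
            (lam - eps) * `|x - y| <= `|f x - f y|]].
Proof.
move=> HF kap0 kl lam1 eps0 eps1 psiL rho01 rhoL def.
(* With this factor the window [rh] of [mcshane_slope] is [rho x], and a node within [4 * r x] keeps
   the extension within [rho x / 8] of [psi]. *)
pose r x := (lam - kap) / 64 * rho x.
have D0 : 0 <= (lam - kap) / 64 by lra.
have r0 x : 0 <= r x by rewrite /r mulr_ge0//; have /andP[] := rho01 x.
have rle x : r x <= rho x / 64.
  have : (lam - kap) * rho x <= 1 * rho x.
    by rewrite ler_wpM2r//; [have /andP[] := rho01 x|lra].
  by rewrite /r; lra.
have r14 x : 0 <= r x <= 4^-1.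
  by rewrite r0/=; have := rle x; have /andP[_] := rho01 x; clear; lra.
have rL x y : `|r x - r y| <= 8^-1 * `|x - y|.
  rewrite /r -mulrBr normrM (ger0_norm D0).
  have e8 : 0 <= 8^-1 :> R by rewrite invr_ge0.
  apply: le_trans (lipwrt_dist HF e8 rhoL x y).
  by rewrite ler_piMl//; lra.
have Q0 : nodes r !=set0 by have [q Qq _] := nodes_cover 0 r14 rL; exists q.
have lam0 : 0 <= lam by lra.
exists (mcshane F lam psi (nodes r)); split.
- exact: mcshane_lip (ltW kl) psiL Q0.
- move=> x; rewrite (mcshane_le _ (ltW kl) psiL Q0) andbT.
  have [q Qq qx] := nodes_cover x r14 rL.
  have := mcshane_ge x (ltW kl) psiL Qq.
  have h := nonexp_dist q x HF; have := psiL q x; rewrite ler_norml => /andP[h1 _].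
  have h2 : (lam + kap) * `|F q - F x| <= 2 * (4 * r x).
    apply: ler_pM => //; [by lra|by lra|exact: le_trans qx].
  by have := rle x; move: h1 h2; clear; lra.
- move=> x rx.
  have rx0 : 0 < r x by rewrite /r mulr_gt0// divr_gt0// subr_gt0.
  have rE : 64 * r x = (lam - kap) * rho x by rewrite /r; clear; lra.
  have dx : deficit F x (rho x) <= eps * (lam - kap) / 128 * r x.
    by apply: (le_trans (def x)); rewrite /r expr2; clear; lra.
  have [y [y1 y2 y3]] :=
    mcshane_slope HF kap0 kl lam1 eps0 eps1 psiL r14 rL rx0 rE dx.
  exists y; split => //; apply: le_trans y1.
  by rewrite /r expr2; clear; lra.
Qed.

End mcshane.

(** * The stages *)

Section stage.
Context {R : realType}.
Local Notation mu := (@lebesgue_measure R).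
Implicit Types (E : set R) (x y z c d eps kap lam L : R) (F f rho : R -> R).

(* [rho] bounds the distance from [f] to all later approximations. *)
Definition stage E F L f rho :=
  [/\ forall x, 0 <= rho x <= 1, lipwrt F (8^-1) rho, lipwrt F L f,
      forall z, rho z = 0 -> flat_at rho z /\ flat_at f z &
      mu (E `&` [set x | rho x = 0%R]) = 0%E].

(** Shrink [rho] to [r], flatten [f] at the zeros of [r], then extend from nodes at the scale of
    [r]. The new tolerance is a small multiple of [r], negligible against the distances over which
    slope [lam] is attained. *)
Lemma stage_step E F f rho L lam eps :
  measurable E -> distribution_of E F -> stage E F L f rho ->
  0 <= L -> L < lam -> lam <= 1 -> 0 < eps -> eps <= 1 ->
  exists f' rho',
  [/\ stage E F lam f' rho', forall x, rho' x <= rho x / 2,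
      forall x, `|f' x - f x| <= rho x / 2 &
      forall x, 0 < rho' x -> exists y,
        [/\ 0 < `|x - y|, `|x - y| <= rho x,
            (lam - eps) * `|x - y| <= `|f' x - f' y| &
            rho' x + rho' y <= eps * `|x - y|]].
Proof.
move=> mE EF [rho01 rhoL fL flat Erho] L0 Ll lam1 eps0 eps1.
have HF := distribution_nonexp mE EF.
have rho0 x : 0 <= rho x by have /andP[] := rho01 x.
(* Half of the gap is spent on flattening, half on the extension. *)
pose kap := (L + lam) / 2; pose D := lam - kap.
have Lk : L < kap by rewrite /kap; lra.
have kl : kap < lam by rewrite /kap; lra.
have kap0 : 0 <= kap by lra.
have kap1 : kap <= 1 by lra.
have D0 : 0 < D by rewrite /D; lra.
have D1 : D <= 1 by rewrite /D; lra.
(* Both the density precision required by [zigzag] and the factor of the new tolerance: [e1 * r x]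
   is a quarter of [eps] times the lower bound for [|x - y|]. *)
pose e1 := eps * D ^+ 2 / 8192.
have D20 : 0 < D ^+ 2 by rewrite exprn_gt0.
have D21 : D ^+ 2 <= 1 by rewrite expr_le1// ltW.
have e10 : 0 < e1 by have := mulr_gt0 eps0 D20; rewrite /e1; clear; lra.
have e1le : e1 <= eps / 8192.
  by have := ler_piMr (ltW eps0) D21; rewrite /e1; clear; lra.
have e11 : e1 <= 1 by move: e1le eps1; clear; lra.
have [r [r1 rL rdef rflat Er]] := good_scale mE EF rho0 rhoL e10 e11 Erho.
have r0 x : 0 <= r x by have /andP[] := r1 x.
have rrho x : r x <= rho x by have /andP[] := r1 x.
have r01 x : 0 <= r x <= 1.
  by rewrite r0 (le_trans (rrho x))//; have /andP[] := rho01 x.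
have [psi [psiL psif psicst]] := exists_flattening mE EF rho0 rhoL r0 rL Er L0 Lk kap1 fL.
have [f' [f'L f'psi f'slope]] := zigzag HF kap0 kl lam1 eps0 eps1 psiL r01 rL rdef.
have f'f x : `|f' x - f x| <= rho x / 2.
  have /andP[p1 p2] := psif x; have /andP[p3 p4] := f'psi x.
  by have := rrho x; have := r0 x; move: p1 p2 p3 p4; clear; rewrite ler_norml; lra.
exists f', (fun x => e1 * r x); split => //.
- split => //.
  + move=> x; rewrite mulr_ge0 ?(ltW e10)//=.
    by have /andP[_ h] := r01 x; rewrite mulr_ile1// ltW.
  + move=> x y; rewrite -mulrBr normrM gtr0_norm//.
    by apply: le_trans (rL x y); rewrite ler_piMl.
  + move=> z /eqP; rewrite mulf_eq0 gt_eqF//= => /eqP rz; split.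
      move=> c c0; have [d d0 Hd] := rflat z rz c c0; exists d => // y /Hd h.
      rewrite -mulrBr normrM gtr0_norm//; apply: le_trans h.
      by rewrite ler_piMl.
    have [rhoz|rhoz] := eqVneq (rho z) 0; last first.
      (* At a new zero, [psi] is locally constant and [f'] is within [r / 8] of it, with [r]
         flat. *)
      have {}rhoz : 0 < rho z by rewrite lt_neqAle eq_sym rhoz rho0.
      have [d1 d10 H1] := psicst z rz rhoz.
      move=> c c0; have [d d0 Hd] := rflat z rz c c0.
      exists (Num.min d d1); first by rewrite lt_min d0.
      move=> y; rewrite lt_min => /andP[/Hd h1 /H1 h2].
      apply: le_trans h1; rewrite rz subr0 (ger0_norm (r0 y)).
      have := f'psi y; have := f'psi z; rewrite h2 rz.
      by have := r0 y; clear; rewrite ler_norml; lra.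
    (* At an old zero, [f'] is within [rho / 2] of [f], and both [rho] and [f] are flat. *)
    have [fr ff] := flat z rhoz.
    move=> c c0; have c20 : 0 < c / 2 by rewrite divr_gt0.
    have [d1 d10 H1] := fr _ c20; have [d2 d20 H2] := ff _ c20.
    exists (Num.min d1 d2); first by rewrite lt_min d10.
    move=> y; rewrite lt_min => /andP[/H1 h1 /H2 h2].
    move: h1; rewrite rhoz subr0 ger0_norm// => h1.
    have := f'f z; rewrite rhoz mul0r normr_le0 subr_eq0 => /eqP ->.
    have h3 := f'f y; have := ler_distD (f y) (f' y) (f z).
    by have := rho0 y; move: h1 h2 h3; clear; lra.
  + rewrite (_ : [set x | e1 * r x = 0] = [set x | r x = 0])//.
    apply/seteqP; split => x /=; last by move=> ->; rewrite mulr0.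
    by move=> /eqP; rewrite mulf_eq0 gt_eqF//= => /eqP.
- move=> x; have : e1 * r x <= 2^-1 * rho x.
    by apply: ler_pM => //; [exact: ltW|move: e1le eps1; clear; lra].
  by clear; lra.
- move=> x; rewrite pmulr_rgt0// => rx.
  have [y []] := f'slope x rx; rewrite -/D => y1 y2 y3; exists y; split => //.
  + by apply: lt_le_trans y1; have := mulr_gt0 D20 rx; clear; lra.
  + exact: le_trans y2 _.
  + have e8 : 0 <= 8^-1 :> R by rewrite invr_ge0.
    have := lipwrt_dist HF e8 rL y x; rewrite ler_norml distrC => /andP[_ h].
    have h1 : e1 * r y <= e1 * (r x + 8^-1 * `|x - y|).
      by rewrite ler_pM2l//; move: h; clear; lra.
    have h2 : eps * (D ^+ 2 / 2048 * r x) <= eps * `|x - y| by rewrite ler_pM2l.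
    have h3 : e1 * `|x - y| <= eps / 8192 * `|x - y| by rewrite ler_wpM2r.
    have h4 : 4 * (e1 * r x) = eps * (D ^+ 2 / 2048 * r x) by rewrite /e1; clear; lra.
    have h5 : 0 <= eps * `|x - y| by rewrite mulr_ge0// ltW.
    by move: h1 h2 h3 h4 h5; clear; lra.
Qed.

Lemma stages E F : measurable E -> distribution_of E F ->
  exists f rho : nat -> R -> R, forall n : nat,
  [/\ stage E F (1 - n.+2%:R^-1) (f n) (rho n),
      forall x, rho n x <= n.+1%:R^-1,
      forall x, rho n.+1 x <= rho n x / 2,
      forall x, `|f n.+1 x - f n x| <= rho n x / 2 &
      forall x, 0 < rho n.+1 x -> exists y,
        [/\ 0 < `|x - y|, `|x - y| <= n.+1%:R^-1,
            (1 - 2 * n.+1%:R^-1) * `|x - y| <= `|f n.+1 x - f n.+1 y| &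
            rho n.+1 x + rho n.+1 y <= n.+1%:R^-1 * `|x - y|]].
Proof.
move=> mE EF.
pose L (n : nat) : R := 1 - n.+2%:R^-1.
have inv0 n : 0 < n.+1%:R^-1 :> R by rewrite invr_gt0.
have invS n : n.+2%:R^-1 < n.+1%:R^-1 :> R by rewrite ltf_pV2 ?posrE// ltr_nat.
have inv1 n : n.+1%:R^-1 <= 1 :> R by rewrite invf_le1// ler1n.
(* The hypothesis sits under the existential, so that choice yields a total function to iterate;
   pairs that are no stage are returned unchanged. *)
have step (np : nat * ((R -> R) * (R -> R))) : exists p',
    stage E F (L np.1) np.2.1 np.2.2 ->
    [/\ stage E F (L np.1.+1) p'.1 p'.2, forall x, p'.2 x <= np.2.2 x / 2,
      forall x, `|p'.1 x - np.2.1 x| <= np.2.2 x / 2 &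
      forall x, 0 < p'.2 x -> exists y,
        [/\ 0 < `|x - y|, `|x - y| <= np.2.2 x,
            (L np.1.+1 - np.1.+1%:R^-1) * `|x - y| <= `|p'.1 x - p'.1 y| &
            p'.2 x + p'.2 y <= np.1.+1%:R^-1 * `|x - y|]].
  case: np => n [f rho] /=.
  have [S|nS] := pselect (stage E F (L n) f rho); last by exists (f, rho).
  have L0 : 0 <= L n by rewrite /L subr_ge0.
  have LS : L n < L n.+1 by rewrite /L ltrD2l ltrN2 invS.
  have L1 : L n.+1 <= 1 by rewrite /L gerBl ltW// inv0.
  have [f' [rho' H]] := stage_step mE EF S L0 LS L1 (inv0 n) (inv1 n).
  by exists (f', rho').
have [G HG] := choice step.
(* The initial tolerance 1 has no zeros, so the conditions at zeros hold vacuously. *)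
pose fix u n : (R -> R) * (R -> R) :=
  if n is m.+1 then G (m, u m) else (fun=> 0, fun=> 1).
have uS n : stage E F (L n) (u n).1 (u n).2.
  elim: n => [|n IH]; last by have [] := HG (n, u n) IH.
  have e8 : 0 <= 8^-1 :> R by rewrite invr_ge0.
  split => //=.
  - by move=> x; rewrite ler01 lexx.
  - exact: lipwrt_cst.
  - by apply: lipwrt_cst; rewrite /L subr_ge0.
  - by move=> z /eqP; rewrite oner_eq0.
  - rewrite (_ : [set _ | _] = set0) ?setI0 ?measure0//.
    by apply/seteqP; split => // x /= /eqP; rewrite oner_eq0.
have ule n x : (u n).2 x <= n.+1%:R^-1.
  elim: n => [|n IH]; first by rewrite /= invr1.
  have [_ h _ _] := HG (n, u n) (uS n).
  apply: (le_trans (h x)).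
  have : n.+1%:R^-1 / 2 <= n.+2%:R^-1 :> R.
    rewrite -invfM lef_pV2 ?posrE// ?mulr_gt0// -natrM ler_nat.
    by rewrite muln2 doubleS !ltnS -addnn leq_addr.
  have : (u n).2 x / 2 <= n.+1%:R^-1 / 2 by rewrite ler_pM2r// invr_gt0.
  by clear; move=> h1 h2; exact: le_trans h1 h2.
exists (fun n => (u n).1), (fun n => (u n).2) => n.
have [h1 h2 h3 h4] := HG (n, u n) (uS n).
split => //; first exact: uS.
move=> x /h4 [y [y1 y2 y3 y4]]; exists y; split => //.
  exact: le_trans y2 (ule n x).
apply: le_trans y3; rewrite ler_wpM2r// /L /=.
have := lt_trans (invS n.+1) (invS n).
by move: (n.+3%:R^-1 : R) (n.+1%:R^-1 : R) => a b; clear; lra.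
Qed.

End stage.

(** * The limit function *)

Section Lip.
Context {R : realType}.
Implicit Types (f : R -> R) (x y z c d e r : R).

Lemma Mf_ge f x y : 0 < `|x - y| ->
  ((`|f x - f y| / `|x - y|)%R%:E <= Mf f x `|x - y|%R)%E.
Proof. by move=> xy; apply: ereal_sup_ubound; exists y => /=. Qed.

Lemma Mf_le f x r c : 0 < r -> (forall y, `|x - y| <= r -> `|f x - f y| <= c * r) ->
  (Mf f x r <= c%:E)%E.
Proof.
move=> r0 H; apply: ge_ereal_sup => _ [y /= xy <-].
by rewrite lee_fin ler_pdivrMr// H.
Qed.

Lemma Lip_le f x c d : 0 < d ->
  (forall y, `|x - y| < d -> `|f x - f y| <= c * `|x - y|) -> 0 <= c ->
  (Lip f x <= c%:E)%E.
Proof.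
move=> d0 H c0; rewrite /Lip limf_esupE.
apply: (@le_trans _ _ (ereal_sup (Mf f x @` [set r | 0 < r < d]))); last first.
  apply: ge_ereal_sup => _ [r /= /andP[r0 rd] <-]; apply: Mf_le => // y xy.
  by apply: (le_trans (H y (le_lt_trans xy rd))); rewrite ler_wpM2l.
apply: ereal_inf_lbound; exists [set r | 0 < r < d] => //.
near=> r; apply/andP; split; first by near: r; exact: nbhs_right_gt.
by near: r; exact: nbhs_right_lt.
Unshelve. all: by end_near. Qed.

Lemma Lip_ge f x c : (forall d, 0 < d -> exists y,
    [/\ 0 < `|x - y|, `|x - y| < d & c * `|x - y| <= `|f x - f y|]) ->
  (c%:E <= Lip f x)%E.
Proof.
move=> H; apply: le_ereal_inf_tmp => _ [V /= [d /= d0 dV] <-].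
have [y [y0 yd yc]] := H d d0.
apply: (@le_trans _ _ (Mf f x `|x - y|%R)).
  apply: le_trans (Mf_ge f y0).
  by rewrite lee_fin ler_pdivlMr.
apply: ereal_sup_ubound; exists `|x - y| => //.
by apply: dV => //=; rewrite sub0r normrN gtr0_norm.
Qed.

Lemma Lip_flat f z : flat_at f z -> Lip f z = 0%E.
Proof.
move=> fz; apply/eqP; rewrite eq_le; apply/andP; split.
  apply/lee_addgt0Pr => e e0; rewrite add0e.
  have [d d0 Hd] := fz e e0.
  apply: (Lip_le d0) (ltW e0) => y yz; have := Hd y.
  by rewrite (distrC y) (distrC (f y)); exact.
(* For the lower bound 0 any nearby point serves. *)
apply: Lip_ge => d d0; exists (z + d / 2); rewrite opprD addNKr normrN.
by rewrite gtr0_norm ?divr_gt0//; split => //; [rewrite gtr_pMr// invf_lt1// ltr1n|rewrite mul0r].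
Qed.

Lemma Lip_steep f x : (forall y, `|f x - f y| <= `|x - y|) ->
  (forall e d, 0 < e -> 0 < d -> exists y,
    [/\ 0 < `|x - y|, `|x - y| < d & (1 - e) * `|x - y| <= `|f x - f y|]) ->
  Lip f x = 1%E.
Proof.
move=> fL H; apply/eqP; rewrite eq_le; apply/andP; split.
  by apply: (@Lip_le f x 1 1) => // y _; rewrite mul1r.
apply/lee_subgt0Pr => e e0; rewrite -EFinB.
by apply: Lip_ge => d d0; exact: H.
Qed.

End Lip.

(** * Convergence of the stages and the exceptional null sets *)

Section main.
Context {R : realType}.
Local Notation mu := (@lebesgue_measure R).

Lemma Lip1_set_borel (E : set R) : measurable E ->
  exists Et : set R, [/\ Gdelta Et, Lip1_set Et & mu.-negligible (E `+` Et)].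
Proof.
move=> mE; have [F EF] := distribution_exists mE.
have HF := distribution_nonexp mE EF.
have [f_ [rho H]] := stages mE EF.
have inv0 n : 0 < n.+1%:R^-1 :> R by rewrite invr_gt0.
have rho0 n x : 0 <= rho n x by have [[/(_ x)/andP[]]] := H n.
have rho1 n x : rho n x <= n.+1%:R^-1 by have [] := H n.
have e8 : 0 <= 8^-1 :> R by rewrite invr_ge0.
have crho n : continuous (rho n).
  by have [[_ rL _ _ _] _ _ _ _] := H n; exact: lipwrt_continuous HF e8 rL.
(* The intervals of radius [rho n x] about [f_ n x] are nested: the radius at least halves and the
   centre moves by at most half of it. The limit is the supremum of the left ends. *)
have lo_mono m n x : (m <= n)%N -> f_ m x - rho m x <= f_ n x - rho n x.
  elim: n => [|n IH]; first by rewrite leqn0 => /eqP ->.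
  rewrite leq_eqVlt => /orP[/eqP->//|]; rewrite ltnS => /IH h.
  have [_ _ /(_ x) h1 /(_ x) h2 _] := H n.
  by move: h2; rewrite ler_norml; move: h h1; clear; lra.
have up_mono m n x : (m <= n)%N -> f_ n x + rho n x <= f_ m x + rho m x.
  elim: n => [|n IH]; first by rewrite leqn0 => /eqP ->.
  rewrite leq_eqVlt => /orP[/eqP->//|]; rewrite ltnS => /IH h.
  have [_ _ /(_ x) h1 /(_ x) h2 _] := H n.
  by move: h2; rewrite ler_norml; move: h h1; clear; lra.
have lo_up m n x : f_ m x - rho m x <= f_ n x + rho n x.
  have [mn|nm] := leqP m n.
    by apply: (le_trans (lo_mono _ _ x mn)); have := rho0 n x; clear; lra.
  apply: le_trans (up_mono _ _ x (ltnW nm)).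
  by have := rho0 m x; clear; lra.
pose g (n : nat) x := f_ n x - rho n x.
pose f := supf setT g.
have fle n x : f x <= f_ n x + rho n x.
  by apply: supf_le; [exists 0%N|move=> m _; exact: lo_up].
have fge n x : f_ n x - rho n x <= f x.
  by apply: (@supf_ge _ _ setT g x (f_ 0%N x + rho 0%N x) n) => // m _; exact: lo_up.
have ff_ n x : `|f_ n x - f x| <= rho n x.
  by rewrite ler_norml; have := fle n x; have := fge n x; clear; lra.
have fF x y : `|f x - f y| <= `|F x - F y|.
  apply/ler_addgt0Pr => e e0.
  have e20 : 0 < e / 2 by rewrite divr_gt0.
  near \oo => n.
  have ne : n.+1%:R^-1 < e / 2 by near: n; exact: near_infty_natSinv_lt (PosNum e20).
  have [[_ _ /(_ x y) fL _ _] _ _ _ _] := H n.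
  have fL1 : `|f_ n x - f_ n y| <= `|F x - F y|.
    apply: (le_trans fL); rewrite ler_piMl// gerBl ltW//.
  have := ff_ n x; have := ff_ n y; have := rho1 n x; have := rho1 n y.
  have := ler_distD (f_ n y) (f x) (f y); have := ler_distD (f_ n x) (f x) (f_ n y).
  rewrite (distrC (f x) (f_ n x)); move: ne fL1; move: (n.+1%:R^-1 : R) => a; clear; lra.
have fdist x y : `|f x - f y| <= `|x - y|.
  by apply: (le_trans (fF x y)); exact: nonexp_dist.
pose Et := \bigcap_n [set x | 0 < rho n x].
have steep x : Et x -> forall e d, 0 < e -> 0 < d -> exists y,
    [/\ 0 < `|x - y|, `|x - y| < d & (1 - e) * `|x - y| <= `|f x - f y|].
  move=> Etx e d e0 d0.
  have e30 : 0 < e / 3 by rewrite divr_gt0.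
  near \oo => n.
  (* Stage [n + 1] loses [2 / (n + 1)] of slope, and passing to the limit at [x] and [y] loses
     [1 / (n + 1)] more. *)
  have ne : n.+1%:R^-1 < e / 3 by near: n; exact: near_infty_natSinv_lt (PosNum e30).
  have nd : n.+1%:R^-1 < d by near: n; exact: near_infty_natSinv_lt (PosNum d0).
  have [_ _ _ _ /(_ x (Etx n.+1 I))[y [y0 yn yf yr]]] := H n.
  exists y; split => //; first exact: le_lt_trans nd.
  have ny : n.+1%:R^-1 * `|x - y| <= e / 3 * `|x - y| by rewrite ler_wpM2r// ltW.
  have := ff_ n.+1 x; have := ff_ n.+1 y.
  have := ler_distD (f y) (f_ n.+1 x) (f_ n.+1 y); have := ler_distD (f x) (f_ n.+1 x) (f y).
  rewrite (distrC (f y)).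
  move: yf yr ny; move: (n.+1%:R^-1 : R) => a; clear; lra.
have flat z : ~ Et z -> flat_at f z.
  move=> /existsNP[n /not_implyP[_ /negP]]; rewrite -leNgt => rz.
  have {}rz : rho n z = 0 by apply/eqP; rewrite eq_le rz rho0.
  (* At a zero of [rho n] the limit agrees with [f_ n], and nearby it differs by at most [rho n],
     which is flat there. *)
  have [[_ _ _ /(_ z rz)[fr fl] _] _ _ _ _] := H n.
  move=> c c0; have c20 : 0 < c / 2 by rewrite divr_gt0.
  have [d1 d10 H1] := fr _ c20; have [d2 d20 H2] := fl _ c20.
  exists (Num.min d1 d2); first by rewrite lt_min d10.
  move=> y; rewrite lt_min => /andP[/H1 h1 /H2 h2].
  move: h1; rewrite rz subr0 ger0_norm// => h1.
  have := ff_ n z; rewrite rz normr_le0 subr_eq0 => /eqP <-.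
  have h3 := ff_ n y; have := ler_distD (f_ n y) (f y) (f_ n z).
  by rewrite (distrC (f y) (f_ n y)); move: h1 h2 h3; clear; lra.
exists Et; split.
- exists (fun n => [set x | 0 < rho n x]) => // n; exact: open_pos.
- exists f; split.
    by apply: (lipwrt_continuous HF ler01) => x y; rewrite mul1r.
  move=> x; rewrite indicE; have [/set_mem Etx|/negP nEtx] := boolP (x \in Et).
    by rewrite Lip_steep//; exact: steep.
  by rewrite Lip_flat//; apply: flat => Etx; apply: nEtx; rewrite inE.
(* [E] minus [Et] is covered by the null zero sets of the [rho n]. A point of [Et] outside [E]
   cannot have density 0: slope 1/2 of [f] forces measure at least [|x - y| / 2] of [E] within
   distance [|x - y|]. *)
- apply: (@negligibleS _ _ _ mu ((\bigcup_n (E `&` [set x | rho n x = 0])) `|`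
    [set x | ~ E x /\ ~ (forall c, 0 < c -> exists2 d, 0 < d &
      forall r, 0 < r -> r < d -> F (x + r) - F (x - r) <= c * r)])).
    move=> x [[Ex nEtx]|[Etx nEx]].
      left; move: nEtx => /existsNP[n /not_implyP[_ /negP]]; rewrite -leNgt => rz.
      by exists n => //; split => //=; apply/eqP; rewrite eq_le rz rho0.
    right; split => // thin.
    have c0 : 0 < 4^-1 :> R by rewrite invr_gt0.
    have [d d0 Hd] := thin _ c0.
    have e0 : 0 < 2^-1 :> R by rewrite invr_gt0.
    have [y [y0 yd yf]] := steep x Etx _ _ e0 d0.
    have h1 := Hd _ y0 yd; have h2 := fF x y.
    suff : `|F x - F y| <= F (x + `|x - y|) - F (x - `|x - y|).
      by move: h1 h2 yf y0; clear; lra.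
    have [xy|yx] := leP x y.
      have xyE : `|x - y| = y - x by rewrite distrC ger0_norm ?subr_ge0.
      rewrite xyE subrKC distrC ger0_norm; last by rewrite subr_ge0 nonexp_le.
      by rewrite lerD2l lerN2 nonexp_le//; move: xy; clear; lra.
    have xyE : `|x - y| = x - y by rewrite gtr0_norm ?subr_gt0.
    rewrite xyE subKr ger0_norm; last by rewrite subr_ge0 nonexp_le// ltW.
    by rewrite lerD2r nonexp_le//; move: yx; clear; lra.
  apply: negligibleU; last exact: distribution_thin.
  apply: negligible_bigcup => n; apply/negligibleP.
    by apply: measurableI => //; apply: closed_measurable; exact: closed_zero.
  by have [[_ _ _ _ h] _ _ _ _] := H n; exact: h.
Unshelve. all: by end_near. Qed.

End main.
Unset Implicit Arguments.

Theorem theorem1p3 (R : realType) (E : set R) :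
  lebesgue_measurable E ->
  exists Et : set R,
    Gdelta Et /\ Lip1_set Et /\
    (@completed_lebesgue_measure R (E `+` Et) = 0)%E.
Proof.
rewrite /lebesgue_measurable -completed_caratheodory_measurable.
(* [E] is a Borel set [A] united with a negligible set [N], so it differs from the [Et] built for
   [A] only inside [N] and the symmetric difference of [A] and [Et]. *)
rewrite g_sigma_completed_algebra_genE => -[/= A mA [N negN ANE]].
have [Et [GEt LEt negEt]] := Lip1_set_borel mA.
exists Et; split=> //; split=> //.
have [B [mB B0 subB]] := negligibleU negN negEt.
apply/eqP; rewrite eq_le; apply/andP; split; last exact: outer_measure_ge0.
rewrite -B0; apply: le_outer_measure; apply: subset_trans subB.
move=> x; rewrite -ANE => -[[[Ax|Nx] nEtx]|[Etx nANx]].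
- by right; left.
- by left.
- by right; right; split => // Ax; apply: nANx; left.
Qed.
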